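(* If two oriented virtual knots are distinguished by $L$-polynomials, then they are distinguished by $F$-polynomials too: if $K_1,K_2$ are oriented virtual knots with $L^n_{K_1}(t,\ell)\neq L^n_{K_2}(t,\ell)$ for some $n\in\mathbb{N}$, then $F^m_{K_1}(t,\ell)\neq F^m_{K_2}(t,\ell)$ for some $m\in\mathbb{N}$. The converse does not hold: there exist oriented virtual knots $K,K'$ such that $L^n_K(t,\ell)=L^n_{K'}(t,\ell)$ for all $n\in\mathbb{N}$ but $F^m_K(t,\ell)\neq F^m_{K'}(t,\ell)$ for some $m\in\mathbb{N}$.
   Context: $\mathbb{N}$ denotes the positive integers. A virtual knot diagram is a one-component planar knot diagram whose double points are either classical crossings (with over/under information) or virtual crossings. An oriented virtual knot is an equivalence class of oriented virtual knot diagrams under planar isotopy, the classical Reidemeister moves RI, RII, RIII, the virtual Reidemeister moves VRI, VRII, VRIII (the same moves with all crossings virtual), and the semi-virtual move SV (an arc with two consecutive virtual crossings is moved past a classical crossing). $C(D)$ is the set of classical crossings of $D$. Sign: draw a classical crossing $c$ with both strands oriented upward. Then $\operatorname{sgn}(c)=+1$ if the over-strand goes from bottom left to top right, and $\operatorname{sgn}(c)=-1$ if the over-strand goes from bottom right to top left. Index: an arc is an edge of $D$ between two consecutive classical crossings along the orientation. Label all arcs by integers so that labels are unchanged at virtual crossings and, at each classical crossing drawn with both strands oriented upward (whatever its sign), if the incoming arc on the left (bottom left) has label $a$ and the incoming arc on the right (bottom right) has label $b$, then the outgoing arc at top left has label $b+1$ and the outgoing arc at top right has label $a-1$. Such a labeling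 always exists: for example, label an arc $\alpha$ by $\lambda(\alpha)=\sum_{c\in O(\alpha)}\operatorname{sgn}(c)$, where $O(\alpha)$ is the set of classical crossings first met as overcrossings when traveling along the orientation starting from $\alpha$. Then $\operatorname{Ind}(c)=\operatorname{sgn}(c)(a-b-1)$. Dwrithe: for $n\in\mathbb{Z}\setminus\{0\}$, the $n$-th writhe is $J_n(D)=\sum_{c\in C(D),\,\operatorname{Ind}(c)=n}\operatorname{sgn}(c)$. For $n\in\mathbb{N}$ the $n$-th dwrithe is $\nabla J_n(D)=J_n(D)-J_{-n}(D)$. Smoothing against orientation: for $c\in C(D)$, $D_c$ is the oriented virtual knot diagram obtained by deleting $c$ and reconnecting so that (with both strands at $c$ oriented upward) the two top ends are joined to each other and the two bottom ends are joined to each other. The result is a one-component diagram, oriented as follows: the path of $D$ that leaves $c$ along the over-strand and returns to $c$ along the under-strand keeps its orientation, and the path that leaves $c$ along the under-strand and returns along the over-strand has its orientation reversed. Polynomials: for $n\in\mathbb{N}$, $L^n_D(t,\ell)=\sum_{c\in C(D)}\operatorname{sgn}(c)\left(t^{\operatorname{Ind}(c)}\ell^{|\nabla J_n(D_c)|}-\ell^{|\nabla J_n(D)|}\right)$ and $$F^{n}_{D}(t,\ell)=\sum_{c\in C(D)}\operatorname{sgn}(c)\,t^{\operatorname{Ind}(c)}\ell^{\nabla J_n(D_c)}-\sum_{c\in T_n(D)}\operatorname{sgn}(c)\,\ell^{\nabla J_n(D_c)}-\sum_{c\in C(D)\setminus T_n(D)}\operatorname{sgn}(c)\,\ell^{\nabla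 J_n(D)},$$ where $T_n(D)=\{c\in C(D)\mid\nabla J_n(D_c)=\pm\nabla J_n(D)\}$. Both are invariants of oriented virtual knots, so for an oriented virtual knot $K$ one writes $L^n_K=L^n_D$ and $F^n_K=F^n_D$ for any diagram $D$ of $K$. *)

(* Defs.v *)
From HB Require Import structures.
From Stdlib Require Import Relations.
From mathcomp Require Import all_boot all_order all_algebra generic_quotient.
From mathcomp Require Import finmap monalg.
From mathcomp Require Import boolp ring.

Set Implicit Arguments.
Unset Strict Implicit.
Unset Printing Implicit Defensive.

Import GRing.Theory Num.Theory.

Local Open Scope ring_scope.
Local Open Scope quotient_scope.

(* A one-component diagram with N double points (classical and virtual) is    *)
(* recorded by the cyclic word of the 2N visits to double points met along    *)
(* the orientation. A visit carries the name of the double point, the level   *)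
(* of the strand followed (Virtual at a virtual crossing) and whether that    *)
(* strand goes from bottom left to top right (rising) or from bottom right    *)
(* to top left when both strands are drawn oriented upward. These data        *)
(* determine the cyclic order of the four edge ends around each double point, *)
(* hence the diagram as an embedded graph.                                    *)

Inductive level := Over | Under | Virtual.

Definition level_code (l : level) : option bool :=
  match l with Over => Some true | Under => Some false | Virtual => None end.
Definition level_decode (c : option bool) : level :=
  match c with Some true => Over | Some false => Under | None => Virtual end.
Lemma level_codeK : cancel level_code level_decode.
Proof. by case. Qed.
HB.instance Definition _ := Equality.copy level (can_type level_codeK).

Record visit := Visit { name : nat; lev : level; rising : bool }.

Definition visit_code (v : visit) := (name v, lev v, rising v).
Definition visit_decode (c : nat * level * bool) := Visit c.1.1 c.1.2 c.2.
Lemma visit_codeK : cancel visit_code visit_decode.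
Proof. by case. Qed.
HB.instance Definition _ := Equality.copy visit (can_type visit_codeK).

Definition opp_level (l : level) : level :=
  match l with Over => Under | Under => Over | Virtual => Virtual end.

(* The other visit to the same double point. *)
Definition mate (v : visit) : visit :=
  Visit (name v) (opp_level (lev v)) (~~ rising v).

Definition classical (v : visit) : bool := lev v != Virtual.

Definition word := seq visit.

Definition wf_word (w : word) : bool :=
  all (fun v => perm_eq [seq u <- w | name u == name v] [:: v; mate v]) w.

(* The dart (v, true) leaves v along its outgoing edge, and (v, false) leaves *)
(* v backwards along its incoming edge. Every edge is the support of exactly  *)
(* two darts. *)
Definition dart := (visit * bool)%type.

Definition darts (w : word) : seq dart :=
  [seq (v, b) | v <- w, b <- [:: true; false]].

(* Follow a dart to its end and turn left there; the orbits of this map are   *)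
(* the boundary walks of the faces, each face lying to the left of its darts. *)
Definition face (w : word) (d : dart) : dart :=
  let u := if d.2 then next w d.1 else prev w d.1 in
  (mate u, d.2 == rising u).

(* Euler's formula: N vertices, 2N edges and N + 2 faces; the crossingless    *)
(* circle has no darts and is planar. *)
Definition planar (w : word) : Prop :=
  w = [::] \/
  exists fs : seq (seq dart),
    [/\ size fs = ((size w)./2 + 2)%N,
        all (fun f => (f != [::]) && fcycle (face w) f) fs &
        perm_eq (flatten fs) (darts w)].

(* The base edge of a word runs from its last visit to its first one (it is   *)
(* the whole circle if the word is empty). A plane diagram is a planar word   *)
(* whose base edge borders the unbounded region, with a boolean telling       *)
(* whether this region is on the left of the base edge.                       *)
Record diagram := Diagram {
  dword :> word;
  outer_left : bool;
  dword_wf : wf_word dword;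
  dword_planar : planar dword
}.

Definition code := (word * bool)%type.

Definition diagram_code (D : diagram) : code := (dword D, outer_left D).

Definition outer_dart (v0 : visit) (c : code) : dart :=
  if c.2 then (last v0 c.1, true) else (head v0 c.1, false).

Inductive planar_isotopy : code -> code -> Prop :=
| Rename (f : nat -> nat) w b of injective f :
    planar_isotopy (w, b)
      ([seq Visit (f (name v)) (lev v) (rising v) | v <- w], b)
| Rebase v0 w b k b' of
    (exists m, iter m (face w) (outer_dart v0 (w, b))
               = outer_dart v0 (rot k w, b')) & (w != [::]) :
    planar_isotopy (w, b) (rot k w, b').

Definition strand := (visit * visit)%type.

Definition strand_word (s : strand) : word := [:: s.1; s.2].
Definition swap_strand (s : strand) : strand := (s.2, s.1).
Definition along (l : level) (s : strand) : bool :=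
  (lev s.1 == l) && (lev s.2 == l).

(* The two darts supported by the edge joining the visits of a strand. *)
Definition strand_darts (s : strand) : seq dart := [:: (s.1, true); (s.2, false)].

Definition triangle (w : word) (s1 s2 s3 : strand) : Prop :=
  exists d1 d2 d3,
    [/\ d1 \in strand_darts s1, d2 \in strand_darts s2, d3 \in strand_darts s3 &
        fcycle (face w) [:: d1; d2; d3] \/ fcycle (face w) [:: d1; d3; d2]].

Definition RIII_strands (ss : seq strand) : bool :=
  has (along Over) ss && has (along Under) ss.
Definition VRIII_strands (ss : seq strand) : bool :=
  all (along Virtual) ss.
Definition SV_strands (ss : seq strand) : bool :=
  has (along Virtual) ss && ~~ all (along Virtual) ss.

(* The base edge is never an inner edge of the changed pattern, so the face   *)
(* that collapses is never the unbounded one. In move_II the condition on     *)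
(* rising says that the two edges between p and q bound a bigon; in move_I    *)
(* the loop always bounds a monogon.                                          *)
Inductive reidemeister : code -> code -> Prop :=
| move_I w1 w2 v b :                                     (* RI and VRI *)
    reidemeister (w1 ++ w2, b) (w1 ++ [:: v; mate v] ++ w2, b)
| move_II w1 w2 w3 p q s b of                            (* RII and VRII *)
    lev q = lev p & rising q = ~~ rising p &
    s = [:: mate p; mate q] \/ s = [:: mate q; mate p] :
    reidemeister (w1 ++ w2 ++ w3, b) (w1 ++ [:: p; q] ++ w2 ++ s ++ w3, b)
| move_III w1 w2 w3 w4 s1 s2 s3 b of                     (* RIII, VRIII, SV *)
    triangle (w1 ++ strand_word s1 ++ w2 ++ strand_word s2 ++ w3
                 ++ strand_word s3 ++ w4) s1 s2 s3 &
    [|| RIII_strands [:: s1; s2; s3], VRIII_strands [:: s1; s2; s3]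
      | SV_strands [:: s1; s2; s3]] :
    reidemeister
      (w1 ++ strand_word s1 ++ w2 ++ strand_word s2 ++ w3
          ++ strand_word s3 ++ w4, b)
      (w1 ++ strand_word (swap_strand s1) ++ w2
          ++ strand_word (swap_strand s2) ++ w3
          ++ strand_word (swap_strand s3) ++ w4, b).

Definition diagram_step (D D' : diagram) : Prop :=
  planar_isotopy (diagram_code D) (diagram_code D') \/
  reidemeister (diagram_code D) (diagram_code D').

Definition diagram_equiv : diagram -> diagram -> Prop :=
  clos_refl_sym_trans diagram diagram_step.

HB.instance Definition _ := gen_eqMixin diagram.
HB.instance Definition _ := gen_choiceMixin diagram.

Definition diagram_eqv (D D' : diagram) : bool := `[< diagram_equiv D D' >].

Lemma diagram_eqv_refl : reflexive diagram_eqv.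
Proof. by move=> D; apply/asboolP/rst_refl. Qed.

Lemma diagram_eqv_sym : symmetric diagram_eqv.
Proof. by move=> D D'; apply/asboolP/asboolP; apply: rst_sym. Qed.

Lemma diagram_eqv_trans : transitive diagram_eqv.
Proof.
move=> D2 D1 D3 /asboolP e12 /asboolP e23; apply/asboolP.
exact: rst_trans e12 e23.
Qed.

Canonical diagram_eqv_rel :=
  EquivRel diagram_eqv diagram_eqv_refl diagram_eqv_sym diagram_eqv_trans.

Definition vknot := {eq_quot diagram_eqv}.

(* A classical crossing is identified with its over-visit. *)
Definition crossings (w : word) : seq visit := [seq v <- w | lev v == Over].

Definition sgn (c : visit) : int := if rising c then 1 else -1.

(* Every edge of w is named by the visit at which it arrives. *)
Definition is_labeling (w : word) (lab : visit -> int) : Prop :=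
  forall v, v \in w ->
    lab (next w v) =
      if ~~ classical v then lab v
      else if rising v then lab v - 1 else lab v + 1.

(* The labeling by the signs of the crossings first met as overcrossings when *)
(* traveling from the edge that arrives at v.                                 *)
Definition arc_label (w : word) (v : visit) : int :=
  let w' := rot (index v w) w in
  \sum_(c <- crossings w | (index c w' < index (mate c) w')%N) sgn c.

Definition in_left (c : visit) : visit := if rising c then c else mate c.
Definition in_right (c : visit) : visit := if rising c then mate c else c.

Definition index_by (lab : visit -> int) (c : visit) : int :=
  sgn c * (lab (in_left c) - lab (in_right c) - 1).

Definition Ind (w : word) (c : visit) : int := index_by (arc_label w) c.

(* Sanity checks: arc_label is a labeling, and any labeling computes Ind.     *)

Lemma mateK : involutive mate.
Proof. by case=> x [] []. Qed.

Lemma mate_neq v : mate v != v.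
Proof. by case: v => x l r; apply/eqP => -[_]; case: r. Qed.

Lemma wf_mem_mate w v : wf_word w -> v \in w -> mate v \in w.
Proof.
move=> /allP wfw /wfw /perm_mem /(_ (mate v)).
by rewrite mem_filter !inE eqxx orbT => /andP[].
Qed.

Lemma wf_uniq w : wf_word w -> uniq w.
Proof.
move=> /allP wfw; apply: count_mem_uniq => v.
have [vw|vw] := boolP (v \in w); last exact/count_memPn.
transitivity (count_mem v [seq u <- w | name u == name v]).
  rewrite count_filter; apply: eq_count => u /=.
  by case: (u =P v) => // ->; rewrite eqxx.
by rewrite (permP (wfw _ vw)) /= eqxx (negPf (mate_neq v)).
Qed.

Lemma rot_head (w : word) i u t :
  uniq w -> rot i w = u :: t -> rot (index u w) w = u :: t.
Proof.
move=> uw ew; have [ile|ige] := leqP (size w) i.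
  by move: ew; rewrite rot_oversize // => ->; rewrite /= eqxx rot0.
suff -> : index u w = i by [].
have eu : nth u w i = u.
  by rewrite -[i in nth _ _ i]addn0 -nth_drop; move: ew; rewrite /rot;
     case: (drop i w) (size_drop i w) => [/eqP|x s _ [-> _] //];
     rewrite eq_sym subn_eq0 leqNgt ige.
by rewrite -[u in index u]eu index_uniq.
Qed.

Lemma mem_crossings w c :
  (c \in crossings w) = (lev c == Over) && (c \in w).
Proof. exact: mem_filter. Qed.

Lemma arc_labelP w : wf_word w -> is_labeling w (arc_label w).
Proof.
move=> wfw v vw; have uw := wf_uniq wfw.
have [s es] : exists s, rot (index v w) w = v :: s.
  by case: (rot_to vw) => i s e; exists s; apply: rot_head e.
have us : uniq (v :: s) by rewrite -es rot_uniq.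
have /andP[vs _] := us.
have ms u : u \in w -> u != v -> u \in s.
  by move=> uin uv; move: uin; rewrite -(mem_rot (index v w)) es inE (negPf uv).
have mvs : mate v \in s by rewrite ms ?mate_neq // wf_mem_mate.
have [u [s' es']] : exists u s', s = u :: s' by case: (s) mvs => // u s' _; exists u, s'.
have eu : next w v = u by rewrite -(next_rot (index v w)) // es es' /= eqxx.
have es2 : rot (index u w) w = rcons s v.
  rewrite es' /=; apply: (@rot_head _ (index v w).+1) => //.
  by rewrite rotS ?index_mem // es es' rot1_cons.
rewrite eu /arc_label es es2.
pose P1 c := (index c (v :: s) < index (mate c) (v :: s))%N.
pose P2 c := (index c (rcons s v) < index (mate c) (rcons s v))%N.
have irc x : x \in s -> index x (rcons s v) = index x s.
  by move=> xs; rewrite -cats1 index_cat xs.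
have irv : index v (rcons s v) = size s.
  by rewrite -cats1 index_cat (negPf vs) /= eqxx addn0.
have Peq c : c \in w -> c != v -> mate c != v -> P1 c = P2 c.
  move=> cw cv mcv; rewrite /P1 /P2 /= !irc ?ms ?wf_mem_mate //.
  by rewrite ![v == _]eq_sym (negPf cv) (negPf mcv).
have P1v : P1 v by rewrite /P1 /= eqxx eq_sym (negPf (mate_neq v)).
have P2v : ~~ P2 v by rewrite /P2 irv irc // -leqNgt index_size.
have P1m : ~~ P1 (mate v) by rewrite /P1 mateK /= eqxx ltn0.
have P2m : P2 (mate v) by rewrite /P2 mateK irv irc // index_mem.
have uc : uniq (crossings w) by rewrite filter_uniq.
rewrite -/(P1 _) !(big_mkcond P1) !(big_mkcond P2) /=.
have special c0 : c0 \in crossings w -> c0 = v \/ c0 = mate v ->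
    \sum_(c <- crossings w) (if P2 c then sgn c else 0)
    = \sum_(c <- crossings w) (if P1 c then sgn c else 0)
      + ((if P2 c0 then sgn c0 else 0) - (if P1 c0 then sgn c0 else 0)).
  move=> c0in ec0; rewrite (bigD1_seq c0) //= [in RHS](bigD1_seq c0) //=.
  rewrite [RHS]addrC addrA subrK; congr (_ + _).
  rewrite big_seq_cond [RHS]big_seq_cond; apply: eq_bigr => c /andP[cin cc0].
  have levc x : x \in crossings w -> lev x = Over.
    by rewrite mem_crossings => /andP[/eqP].
  have cw : c \in w by move: cin; rewrite mem_crossings => /andP[].
  have lc := levc _ cin; have lc0 := levc _ c0in.
  rewrite Peq //; case: ec0 => e.
  - by rewrite -e.
  - by apply/eqP => ecv; move: lc0; rewrite e -ecv /= lc.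
  - by apply/eqP => ecv; move: lc0; rewrite -e in ecv *; rewrite -ecv /= lc.
  - by apply: contra cc0 => /eqP ecv; rewrite e -ecv mateK.
case lv: (lev v).
- have vc : v \in crossings w by rewrite mem_crossings lv.
  rewrite (special v vc (or_introl erefl)) P1v (negPf P2v) /classical lv /sgn.
  by case: (rising v) => //=; rewrite sub0r ?opprK.
- have mc : mate v \in crossings w.
    by rewrite mem_crossings /= lv wf_mem_mate.
  rewrite (special _ mc (or_intror erefl)) P2m (negPf P1m).
  by rewrite /classical lv /sgn /= subr0; case: (rising v).
- rewrite /classical lv /= big_seq [RHS]big_seq; apply: eq_bigr => c.
  rewrite mem_crossings => /andP[/eqP lc cw]; rewrite Peq //.
    by apply/eqP => e; rewrite e lv in lc.
  by apply/eqP => /(congr1 lev); rewrite /= lc lv.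
Qed.

Lemma labeling_diff w lab lab' : wf_word w ->
  is_labeling w lab -> is_labeling w lab' ->
  {in w &, forall u v, lab u - lab v = lab' u - lab' v}.
Proof.
move=> wfw H H'; have uw := wf_uniq wfw.
case ew: w => [//|x0 t]; rewrite -ew.
suff C v : v \in w -> lab v - lab' v = lab x0 - lab' x0.
  move=> u v /C eu /C ev; apply/eqP; rewrite subr_eq addrAC -subr_eq.
  by rewrite opprK -[lab u](subrK (lab' u)) eu -ev; apply/eqP; ring.
move=> vw; rewrite -(nth_index x0 vw).
have : (index v w < size w)%N by rewrite index_mem.
elim: (index v w) => [|i IHi] iw; first by rewrite ew.
have iw' := ltnW iw; rewrite -IHi //.
have nw : nth x0 w i \in w by rewrite mem_nth.
have <- : next w (nth x0 w i) = nth x0 w i.+1.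
  by rewrite next_nth nw ew -ew index_uniq // ew.
by rewrite H // H' //; case: ifP => // _; case: ifP => _; ring.
Qed.

Lemma Ind_labeling w lab c : wf_word w -> is_labeling w lab ->
  c \in crossings w -> Ind w c = index_by lab c.
Proof.
move=> wfw H; rewrite mem_crossings => /andP[_ cw]; rewrite /Ind /index_by.
rewrite (labeling_diff wfw (arc_labelP wfw) H) //.
  by rewrite /in_left; case: ifP => // _; apply: wf_mem_mate.
by rewrite /in_right; case: ifP => // _; apply: wf_mem_mate.
Qed.

Definition writhe (n : int) (w : word) : int :=
  \sum_(c <- crossings w | Ind w c == n) sgn c.

Definition dwrithe (n : nat) (w : word) : int :=
  writhe n%:Z w - writhe (- n%:Z) w.

Definition toggle (v : visit) : visit := Visit (name v) (lev v) (~~ rising v).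

(* A is the path from the over-strand to the under-strand of c, which keeps   *)
(* its orientation; B is the other one, which is reversed. At a double point  *)
(* where exactly one strand gets reversed, the two strands exchange the roles *)
(* "bottom left to top right" and "bottom right to top left"; nothing changes *)
(* at the double points where both strands get reversed.                      *)
Definition smooth (w : word) (c : visit) : word :=
  let s := behead (rot (index c w) w) in
  let A := take (index (mate c) s) s in
  let B := drop (index (mate c) s).+1 s in
  [seq (if (v \in A) != (mate v \in A) then toggle v else v) | v <- A ++ rev B].

(* Laurent polynomials in t and l with integer coefficients, as finitely      *)
(* supported families of integers indexed by pairs of exponents.              *)
Definition laurent := {malg int[(int * int)%type]}.

(* The term a t^i l^j. *)
Definition term (a i j : int) : laurent := << a *g (i, j) >>.

Definition Lpoly (n : nat) (w : word) : laurent :=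
  \sum_(c <- crossings w)
    (term (sgn c) (Ind w c) `|dwrithe n (smooth w c)|
     - term (sgn c) 0 `|dwrithe n w|).

Definition inT (n : nat) (w : word) (c : visit) : bool :=
  (dwrithe n (smooth w c) == dwrithe n w)
  || (dwrithe n (smooth w c) == - dwrithe n w).

Definition Fpoly (n : nat) (w : word) : laurent :=
  \sum_(c <- crossings w) term (sgn c) (Ind w c) (dwrithe n (smooth w c))
  - \sum_(c <- crossings w | inT n w c) term (sgn c) 0 (dwrithe n (smooth w c))
  - \sum_(c <- crossings w | ~~ inT n w c) term (sgn c) 0 (dwrithe n w).

(* The polynomials of a knot are computed on a representative diagram. *)
Definition knotL (n : nat) (K : vknot) : laurent := Lpoly n (repr K).
Definition knotF (n : nat) (K : vknot) : laurent := Fpoly n (repr K).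

(* Main.v *)
Require Import Defs.
From mathcomp Require Import all_boot all_order all_algebra generic_quotient.
From mathcomp Require Import finmap monalg ring zify.
From mathcomp Require Import boolp.

Set Implicit Arguments.
Unset Strict Implicit.
Unset Printing Implicit Defensive.

Import GRing.Theory Num.Theory.
Local Open Scope ring_scope.
Local Open Scope quotient_scope.

(** Give a visit the weight 1 or -1 according as its strand rises to the right
    or to the left at a classical crossing, and the weight 0 at a virtual one.
    The two visits to a double point have opposite weights, and Ind c is the sum
    of the weights met strictly between the over-visit c and its mate (Ind_gap).
    For any visit v let gap v be the same sum from v to mate v. Since
    gap (mate v) = - gap v, the dwrithe nabla J_n is the sum of the weights of
    all the visits v with gap v = n (dwritheE). This formula ignores the virtual
    crossings and the distinction between over and under. It applies to the
    smoothing D_c as well: its visits form the word A ++ rev B, where A and B are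
    the two paths cut out by c, and a weight changes sign exactly when the two
    visits to its double point lie one in A and one in B (dwrithe_smooth).

    F determines L. On T_n the numbers nabla J_n(D_c) and nabla J_n(D) have the
    same absolute value, so replacing every exponent of l in F^n_D by its
    absolute value yields L^n_D (Lpoly_coeff). Hence L^n differs only if F^n does.

    The converse needs the invariance of F, because the polynomials of a knot are
    computed on an unknown representative (knotF_pi). Changes of base point and
    names are harmless. Under a Reidemeister move, a crossing c outside the
    pattern keeps its index, and the words of the two smoothings at c are related
    by the same kind of move, which preserves dwrithes
    (removal_smooth, smooth_third_core). The crossings of the pattern contribute
    as follows.
    - In a first move the new crossing has index 0 and its smoothing is the
      other diagram of the move or its reverse, so its term in F vanishes
      (Fpoly_first).
    - In a second move the two new crossings have opposite signs, the same index,
      and smoothings with the same dwrithes, so their terms cancel (Fpoly_second).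
    - In a third move, the smoothings at a crossing of the triangle differ by
      sliding an arc past the third strand, which preserves dwrithes
      (flat_writhe_cap, smooth_third_first).

    For the converse itself, switch all the crossings of D and reflect the plane.
    On words this replaces every visit by its mate. Signs, indices and
    nabla J_n(D) are kept, but the two paths at a crossing exchange their roles,
    so nabla J_n(D_c) is negated. Hence L^n is unchanged for every n
    (Lpoly_mirror), while for k <> 0 the coefficient of t^k l^j in F^n becomes
    that of t^k l^(-j) (Fpoly_mirror_coeff). In a diagram with four classical
    crossings, t l^2 has coefficient 1 in F^1 and t l^(-2) has coefficient 0
    (example_coeff). *)

(** * Running sums along a word *)

(** The weight of a visit: the sign of the crossing at an over-visit, its
    opposite at an under-visit, 0 at a virtual crossing. *)
Definition wt (v : visit) : int :=
  if classical v then (if rising v then 1 else -1) else 0.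

(** A repetition-free word containing both visits to each of its double points. *)
Definition closed_word (u : word) : Prop :=
  uniq u /\ {in u, forall v, mate v \in u}.

(** A weight function taking opposite values at the two visits to a double
    point. *)
Definition odd_on (e : visit -> int) (u : word) : Prop :=
  {in u, forall v, e (mate v) = - e v}.

(** Q lists the running sums of e along u, starting from z: Q v is z plus the
    weights of the letters before v. Only the values of Q on u are constrained. *)
Fixpoint chain (e Q : visit -> int) (z : int) (u : word) : Prop :=
  if u is v :: u' then Q v = z /\ chain e Q (z + e v) u' else True.

(** The running sums starting from 0. The value is junk outside u. *)
Fixpoint pre (e : visit -> int) (u : word) (v : visit) : int :=
  if u is x :: u' then (if x == v then 0 else e x + pre e u' v) else 0.

(** If Q is made of running sums along a closed word of total weight 0, this is
    the sum of the weights met strictly between v and mate v, in cyclic order;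
    no base point intervenes because Q enters by a difference. *)
Definition gap (e Q : visit -> int) (v : visit) : int := Q (mate v) - Q v - e v.

(** The n-th dwrithe as a function of the weights alone. *)
Definition flat_writhe (n : int) (e : visit -> int) (u : word) : int :=
  \sum_(v <- u | gap e (pre e u) v == n) e v.

(** The total weight of a word. *)
Definition tot (e : visit -> int) (u : word) : int := \sum_(x <- u) e x.

Lemma tot_nil e : tot e [::] = 0.
Proof. exact: big_nil. Qed.

Lemma tot_cons e x u : tot e (x :: u) = e x + tot e u.
Proof. exact: big_cons. Qed.

Lemma tot_cat e u1 u2 : tot e (u1 ++ u2) = tot e u1 + tot e u2.
Proof. exact: big_cat. Qed.

Lemma perm_tot e u1 u2 : perm_eq u1 u2 -> tot e u1 = tot e u2.
Proof. exact: perm_big. Qed.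

Lemma mate_inj : injective mate.
Proof. exact: can_inj mateK. Qed.

Lemma wt_mate v : wt (mate v) = - wt v.
Proof. by case: v => x [] []. Qed.

Lemma wt_sgn c : lev c = Over -> wt c = sgn c.
Proof. by case: c => x [] []. Qed.

Lemma perm_swap2 (x y : visit) : perm_eq [:: x; y] [:: y; x].
Proof. exact: permEl (perm_catC [:: x] [:: y]). Qed.

Lemma closed_perm_mate u : closed_word u -> perm_eq (map mate u) u.
Proof.
case=> uu cu; apply: uniq_perm => //; first by rewrite map_inj_uniq //; exact: mate_inj.
move=> v; apply/mapP/idP => [[x xu ->]|vu]; first exact: cu.
by exists (mate v); rewrite ?mateK ?cu.
Qed.

Lemma closed_word_perm u u' : perm_eq u u' -> closed_word u -> closed_word u'.
Proof.
move=> p [uu cu]; split; first by rewrite -(perm_uniq p).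
by move=> v; rewrite -!(perm_mem p); apply: cu.
Qed.

Lemma closed_wf w : wf_word w -> closed_word w.
Proof. by move=> wfw; split; [exact: wf_uniq | move=> v; exact: wf_mem_mate]. Qed.

Lemma tot0 e u : closed_word u -> odd_on e u -> tot e u = 0.
Proof.
move=> cu oe; have : tot e u = - tot e u; last by lia.
rewrite -[in LHS](perm_tot _ (closed_perm_mate cu)) /tot big_map -sumrN.
by rewrite big_seq [RHS]big_seq; apply: eq_bigr => v /oe.
Qed.

Lemma chain_cat e Q z u1 u2 :
  chain e Q z (u1 ++ u2) <-> chain e Q z u1 /\ chain e Q (z + tot e u1) u2.
Proof.
elim: u1 z => [|x u1 IH] z /=; first by rewrite tot_nil addr0; tauto.
by rewrite IH tot_cons addrA; tauto.
Qed.

Lemma eq_chain e e' Q Q' z u :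
  {in u, e =1 e'} -> {in u, Q =1 Q'} -> chain e Q z u -> chain e' Q' z u.
Proof.
elim: u z => //= x u IH z ee eQ [Qx ch].
rewrite -eQ ?mem_head // -ee ?mem_head //; split => //.
by apply: IH ch => v vu; [apply: ee|apply: eQ]; rewrite inE vu orbT.
Qed.

Lemma chain_shift e Q z u d :
  chain e Q z u -> chain e (fun v => d + Q v) (d + z) u.
Proof. by elim: u z => //= x u IH z [-> /IH]; rewrite addrA. Qed.

(** Two systems of running sums along the same letters differ by a constant. *)
Lemma chain_diff e e' Q Q' z z' u : {in u, e =1 e'} ->
  chain e Q z u -> chain e' Q' z' u -> {in u, forall v, Q' v = Q v + (z' - z)}.
Proof.
elim: u z z' => //= x u IH z z' ee [Qx ch] [Qx' ch'] v.
have ex : e x = e' x by apply: ee; rewrite mem_head.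
rewrite inE => /predU1P[->|vu]; first by rewrite Qx Qx'; lia.
rewrite (IH _ _ _ ch ch' v vu) ?ex; first by lia.
by move=> y yu; apply: ee; rewrite inE yu orbT.
Qed.

Lemma chain_pre e u : uniq u -> chain e (pre e u) 0 u.
Proof.
elim: u => //= x u IH /andP[xu uu]; rewrite eqxx; split => //.
have := chain_shift (e x) (IH uu); rewrite addrC.
apply: eq_chain => // v vu.
by case: eqP => // xv; rewrite xv vu in xu.
Qed.

Lemma chain_rev e Q z u : chain e Q z u ->
  chain e (fun v => - Q v - e v) (- z - tot e u) (rev u).
Proof.
elim: u z => //= x u IH z [Qx /IH ch].
rewrite rev_cons -cats1; apply/chain_cat; rewrite tot_cons; split.
  by move: ch; congr (chain _ _ _ _); lia.
have -> : tot e (rev u) = tot e u by apply: perm_tot; rewrite perm_rev.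
by rewrite /= Qx; split => //; ring.
Qed.

(** The dwrithe can be computed with any system of running sums. *)
Lemma flat_writhe_chain n e Q z u : closed_word u -> chain e Q z u ->
  flat_writhe n e u = \sum_(v <- u | gap e Q v == n) e v.
Proof.
case=> uu cu ch; have d := chain_diff (fun _ _ => erefl) ch (chain_pre e uu).
rewrite /flat_writhe big_seq_cond [RHS]big_seq_cond; apply: eq_bigl => v.
case vu: (v \in u) => //=; congr (_ == _); rewrite /gap !d ?cu //; lia.
Qed.

Lemma eq_flat_writhe n e e' u : closed_word u -> {in u, e =1 e'} ->
  flat_writhe n e u = flat_writhe n e' u.
Proof.
move=> cu ee; have [uu mu] := cu.
rewrite (flat_writhe_chain n cu (eq_chain ee (fun _ _ => erefl) (chain_pre e uu))).
rewrite /flat_writhe big_seq_cond [RHS]big_seq_cond; apply: eq_big => v.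
  by case vu: (v \in u) => //=; rewrite /gap ee.
by case/andP=> /ee.
Qed.

Lemma chain_map e Q z (g : visit -> visit) u :
  chain e Q z (map g u) <-> chain (e \o g) (Q \o g) z u.
Proof. by elim: u z => //= x u IH z; rewrite IH. Qed.

Lemma closed_map (g : visit -> visit) u : closed_word u -> {in u &, injective g} ->
  {in u, forall v, g (mate v) = mate (g v)} -> closed_word (map g u).
Proof.
move=> [uu cu] gi gm; split; first by rewrite map_inj_in_uniq.
by move=> _ /mapP[x xu ->]; rewrite -gm // map_f // cu.
Qed.

Lemma flat_writhe_map n e (g : visit -> visit) u :
  closed_word u -> {in u &, injective g} ->
  {in u, forall v, g (mate v) = mate (g v)} ->
  flat_writhe n e (map g u) = flat_writhe n (e \o g) u.
Proof.
move=> cu gi gm; have [umu _] := closed_map cu gi gm.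
have /chain_map ch := chain_pre e umu.
rewrite (flat_writhe_chain n cu ch) /flat_writhe big_map.
rewrite big_seq_cond [RHS]big_seq_cond; apply: eq_bigl => v.
by case vu: (v \in u) => //=; rewrite /gap /= gm.
Qed.

Lemma flat_writhe_rot n e k u : closed_word u -> odd_on e u ->
  flat_writhe n e (rot k u) = flat_writhe n e u.
Proof.
move=> cu oe; have [uu _] := cu; have t0 := tot0 cu oe.
have := chain_pre e uu; rewrite -{2}(cat_take_drop k u) => /chain_cat[c1 c2].
have p : perm_eq (rot k u) u by rewrite perm_rot.
have cr : closed_word (rot k u) by apply: closed_word_perm cu; rewrite perm_sym.
have ch : chain e (pre e u) (0 + tot e (take k u)) (rot k u).
  apply/chain_cat; split => //; move: t0.
  by rewrite -{1}(cat_take_drop k u) tot_cat -addrA => ->; rewrite addr0.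
by rewrite (flat_writhe_chain n cr ch) /flat_writhe (perm_big _ p).
Qed.

Lemma gap_mate e Q u v : odd_on e u -> v \in u -> gap e Q (mate v) = - gap e Q v.
Proof. by move=> oe vu; rewrite /gap mateK oe //; lia. Qed.

Lemma sum_gap_opp n e Q u : closed_word u -> odd_on e u ->
  \sum_(v <- u | - gap e Q v == n) e v = - \sum_(v <- u | gap e Q v == n) e v.
Proof.
move=> cu oe; rewrite -[in LHS](perm_big _ (closed_perm_mate cu)) /= big_map -sumrN.
rewrite big_seq_cond [RHS]big_seq_cond; apply: eq_big => v.
  by case vu: (v \in u) => //=; rewrite (gap_mate _ oe) // opprK.
by case/andP=> /oe.
Qed.

(** Reversing a word changes the sign of all the gaps, hence of the dwrithes. *)
Lemma flat_writhe_rev n e u : closed_word u -> odd_on e u ->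
  flat_writhe n e (rev u) = - flat_writhe n e u.
Proof.
move=> cu oe; have [uu mu] := cu; have p : perm_eq u (rev u) by rewrite perm_sym perm_rev.
rewrite (flat_writhe_chain n (closed_word_perm p cu) (chain_rev (chain_pre e uu))).
rewrite -(perm_big _ p) /= -sum_gap_opp // big_seq_cond [RHS]big_seq_cond.
apply: eq_bigl => v; case vu: (v \in u) => //=; congr (_ == _).
by rewrite /gap oe //; lia.
Qed.

Lemma flat_writhe_map_mate n e u : closed_word u -> odd_on e u ->
  flat_writhe n e (map mate u) = flat_writhe n (fun v => - e v) u.
Proof.
move=> cu oe; rewrite flat_writhe_map //; last by move=> x y _ _; apply: mate_inj.
by apply: eq_flat_writhe => // v /oe.
Qed.

(** * The index and the dwrithe as running sums *)

Lemma chain_rot e Q z k u : chain e Q z u -> tot e u = 0 ->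
  chain e Q (z + tot e (take k u)) (rot k u).
Proof.
rewrite -{1 2}(cat_take_drop k u) => /chain_cat[c1 c2] t0.
apply/chain_cat; split => //; move: t0; rewrite tot_cat => t0.
by rewrite -addrA t0 addr0.
Qed.

Lemma wt_odd u : odd_on wt u.
Proof. by move=> v _; exact: wt_mate. Qed.

(** Up to sign, the running sums of the weights label the arcs as required to
    compute the index. *)
Lemma labeling_pre w : wf_word w -> is_labeling w (fun v => - pre wt w v).
Proof.
move=> /closed_wf cw v vw; have [uw mw] := cw.
have t0 : tot wt w = 0 by apply: tot0 => //; apply: wt_odd.
suff -> : pre wt w (next w v) = pre wt w v + wt v.
  by rewrite /wt; case: (classical v) => /=; case: (rising v); lia.
have [k s es] := rot_to vw; have := chain_rot k (chain_pre wt uw) t0.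
have : mate v \in rot k w by rewrite mem_rot mw.
rewrite -(next_rot k) // es inE (negPf (mate_neq v)) /=.
by case: s es => //= y s _ _; rewrite eqxx => -[-> [-> _]].
Qed.

Lemma Ind_gap w c : wf_word w -> c \in crossings w ->
  Ind w c = gap wt (pre wt w) c.
Proof.
move=> wfw cw; rewrite (Ind_labeling wfw (labeling_pre wfw) cw).
have : wt c = sgn c by apply: wt_sgn; move: cw; rewrite mem_crossings => /andP[/eqP].
rewrite /index_by /gap /in_left /in_right /sgn => ->.
by case: (rising c); lia.
Qed.

(** A crossing of index n contributes through its over-visit, and one of index
    -n through its under-visit, whose weight is minus the sign and whose gap is
    n. *)
Lemma dwritheE n w : wf_word w -> dwrithe n w = flat_writhe n%:Z wt w.
Proof.
move=> wfw; have cw := closed_wf wfw; pose g := gap wt (pre wt w).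
have gm v : v \in w -> g (mate v) = - g v by move=> vw; apply: (gap_mate _ (@wt_odd w)).
have E m : writhe m w = \sum_(v <- w | (lev v == Over) && (g v == m)) wt v.
  rewrite /writhe big_filter_cond big_seq_cond [RHS]big_seq_cond; apply: eq_big => v.
    case vw: (v \in w) => //=; case lv: (lev v == Over) => //=.
    by rewrite Ind_gap // mem_crossings lv.
  by case/and3P=> _ /eqP /wt_sgn.
rewrite /flat_writhe -/g (bigID (fun v => lev v == Over)) /=.
rewrite /dwrithe !E; congr (_ + _); first by apply: eq_bigl => v; rewrite andbC.
rewrite [RHS](bigID (fun v => lev v == Under)) /= [RHS]addrC.
rewrite [X in _ = X + _]big1 ?add0r; last first.
  by move=> v; rewrite /wt /classical; case: (lev v); rewrite ?andbF.
rewrite -(perm_big _ (closed_perm_mate cw)) /= big_map -sumrN.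
rewrite big_seq_cond [RHS]big_seq_cond; apply: eq_big => v; last by rewrite wt_mate opprK.
case vw: (v \in w) => //=; rewrite gm // eqr_oppLR opprK.
by case: (lev v); rewrite ?andbF ?andbT.
Qed.

(** * Smoothings as reweighted words *)

(** The weight of v after a smoothing that keeps the orientation of the path A
    and reverses the other one. *)
Definition swt (A : word) (v : visit) : int :=
  if (v \in A) == (mate v \in A) then wt v else - wt v.

(** The letter by which v is replaced in such a smoothing. *)
Definition tog (A : word) (v : visit) : visit :=
  if (v \in A) != (mate v \in A) then toggle v else v.

Lemma swt_odd A u : odd_on (swt A) u.
Proof. by move=> v _; rewrite /swt mateK eq_sym wt_mate; case: ifP. Qed.

Lemma tog_mate A v : tog A (mate v) = mate (tog A v).
Proof. by rewrite /tog mateK eq_sym; case: ifP. Qed.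

Lemma wt_tog A v : wt (tog A v) = swt A v.
Proof.
rewrite /tog /swt; case: eqP => //= _.
by rewrite /wt /classical /=; case: (lev v) => //=; case: (rising v); rewrite ?opprK.
Qed.

Lemma wf_same_name w u v : wf_word w -> u \in w -> v \in w ->
  name u = name v -> u = v \/ u = mate v.
Proof.
move=> /allP wfw uw /wfw /perm_mem /(_ u); rewrite mem_filter uw andbT => + nuv.
by rewrite nuv eqxx !inE => /esym/orP[]/eqP; [left|right].
Qed.

(** Well-formedness is closure together with the fact that a name is used by
    only one double point. *)
Lemma wf_intro w : closed_word w ->
  {in w &, forall u v, name u = name v -> u = v \/ u = mate v} -> wf_word w.
Proof.
move=> [uw mw] nw; apply/allP => v vw; apply: uniq_perm.
- exact: filter_uniq.
- by rewrite /= inE eq_sym mate_neq.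
move=> u; rewrite mem_filter !inE; apply/andP/orP.
  by case=> /eqP e uw'; case: (nw u v) => // ->; rewrite eqxx; [left|right].
by case=> /eqP ->; rewrite ?mw ?eqxx.
Qed.

(** The word w, read from c, is c A (mate c) B. *)
Section Smoothing.

Variables (w : word) (k : nat) (c : visit) (A B : word).
Hypotheses (wfw : wf_word w) (ew : rot k w = c :: A ++ mate c :: B).

Lemma smooth_uniq : uniq (c :: mate c :: A ++ B).
Proof.
have p : perm_eq (rot k w) (c :: mate c :: A ++ B).
  by rewrite ew perm_cons perm_catC /= perm_cons perm_catC.
by rewrite -(perm_uniq p) rot_uniq wf_uniq.
Qed.

Lemma smooth_mem v : (v \in w) = (v \in c :: mate c :: A ++ B).
Proof.
by rewrite -(mem_rot k) ew !(inE, mem_cat); do 2 case: eqP => //=; rewrite ?orbT.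
Qed.

Lemma smooth_closed : closed_word (A ++ rev B).
Proof.
have := smooth_uniq; rewrite /= inE !negb_or => /and3P[/andP[_ cAB] mcAB uAB].
split; first by move: uAB; rewrite !cat_uniq rev_uniq has_rev.
move=> v; rewrite !mem_cat !mem_rev -!mem_cat => vAB.
have : mate v \in w by rewrite wf_mem_mate // smooth_mem !inE vAB !orbT.
rewrite smooth_mem !inE (inj_eq mate_inj); case: eqP => [ev|_] /=.
  by rewrite -ev mateK vAB in mcAB.
by case: eqP => [ev|//]; rewrite -ev vAB in cAB.
Qed.

Lemma smoothE : smooth w c = map (tog A) (A ++ rev B).
Proof.
have := smooth_uniq; rewrite /= inE !negb_or => /and3P[/andP[_ cAB] mcAB uAB].
have er : rot (index c w) w = c :: A ++ mate c :: B.
  by apply: rot_head ew; apply: wf_uniq.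
have ei : index (mate c) (A ++ mate c :: B) = size A.
  rewrite index_cat /= eqxx addn0; case: ifP => // h.
  by rewrite mem_cat h in mcAB.
by rewrite /smooth er /= ei take_size_cat // -cat_rcons drop_size_cat // size_rcons.
Qed.

Lemma smooth_mem_sub v : v \in A ++ rev B -> v \in w.
Proof. by rewrite mem_cat mem_rev smooth_mem !inE mem_cat => ->; rewrite !orbT. Qed.

Lemma tog_same u v : u \in A ++ rev B -> v \in A ++ rev B ->
  name u = name v -> u = v \/ u = mate v.
Proof. by move=> /smooth_mem_sub uw /smooth_mem_sub vw; apply: wf_same_name wfw uw vw. Qed.

Lemma name_tog v : name (tog A v) = name v.
Proof. by rewrite /tog; case: ifP. Qed.

Lemma tog_inj : {in A ++ rev B &, injective (tog A)}.
Proof.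
move=> u v ui vi e; have := congr1 name e; rewrite !name_tog.
case/(tog_same ui vi) => // eu; move: e; rewrite eu tog_mate => /eqP.
by rewrite (negPf (mate_neq _)).
Qed.

Lemma wf_smooth : wf_word (smooth w c).
Proof.
rewrite smoothE; apply: wf_intro.
  by apply: closed_map smooth_closed tog_inj _ => v _; exact: tog_mate.
move=> _ _ /mapP[u ui ->] /mapP[v vi ->]; rewrite !name_tog => /(tog_same ui vi).
by case=> ->; [left|right; rewrite tog_mate].
Qed.

Lemma dwrithe_smooth n :
  dwrithe n (smooth w c) = flat_writhe n%:Z (swt A) (A ++ rev B).
Proof.
rewrite (dwritheE _ wf_smooth) smoothE flat_writhe_map.
- by apply: eq_flat_writhe smooth_closed _ => v _; exact: wt_tog.
- exact: smooth_closed.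
- exact: tog_inj.
- by move=> v _; exact: tog_mate.
Qed.

End Smoothing.

Lemma rot_split w c : wf_word w -> c \in w ->
  exists k A B, rot k w = c :: A ++ mate c :: B.
Proof.
move=> wfw cw; have [k s es] := rot_to cw.
have ms : mate c \in s.
  have := wf_mem_mate wfw cw.
  by rewrite -(mem_rot k) es inE (negPf (mate_neq c)).
by case/splitPr: ms es => A B es; exists k, A, B.
Qed.

(** * The F-polynomial as one sum over crossings *)

(** The contribution to F of a crossing of sign s and index i, where a and d
    stand for the n-th dwrithes of D_c and of D. *)
Definition Fsummand (s i a d : int) : laurent :=
  term s i a - term s 0 (if (a == d) || (a == - d) then a else d).

Definition Fterm (n : nat) (w : word) (c : visit) : laurent :=
  Fsummand (sgn c) (Ind w c) (dwrithe n (smooth w c)) (dwrithe n w).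

Lemma sumrB_if (V : zmodType) (I : Type) (s : seq I) (P : pred I) (F G H : I -> V) :
  \sum_(i <- s) F i - \sum_(i <- s | P i) G i - \sum_(i <- s | ~~ P i) H i
  = \sum_(i <- s) (F i - if P i then G i else H i).
Proof.
rewrite sumrB -addrA -opprD; congr (_ - _).
rewrite [RHS](bigID P) /=; congr (_ + _); apply: eq_bigr => i.
  by move=> ->.
by move=> /negPf ->.
Qed.

Lemma FpolyE n w : Fpoly n w = \sum_(c <- crossings w) Fterm n w c.
Proof.
rewrite /Fpoly sumrB_if; apply: eq_bigr => c _.
by rewrite /Fterm /Fsummand /inT; case: ifP.
Qed.

Lemma sum_perm_cat (V : zmodType) (I : eqType) (s s0 s' : seq I) (F F' : I -> V) :
  perm_eq s (s0 ++ s') -> \sum_(i <- s0) F i = 0 -> {in s', F =1 F'} ->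
  \sum_(i <- s) F i = \sum_(i <- s') F' i.
Proof.
move=> p s00 FF'; rewrite (perm_big _ p) big_cat /= s00 add0r.
by rewrite big_seq [RHS]big_seq; apply: eq_bigr.
Qed.

Lemma sum_map_in (V : zmodType) (I J : eqType) (g : J -> I) (s : seq J)
    (F : I -> V) (F' : J -> V) : {in s, forall j, F (g j) = F' j} ->
  \sum_(i <- map g s) F i = \sum_(j <- s) F' j.
Proof. by move=> FF'; rewrite big_map big_seq [RHS]big_seq; apply: eq_bigr. Qed.

(** F is unchanged if extra letters pl are added whose crossings have terms that
    cancel, without altering the data of the other crossings. *)
Lemma eq_Fpoly_extra n w w' pl : perm_eq w (pl ++ w') ->
  dwrithe n w = dwrithe n w' ->
  {in crossings w', forall c, Ind w c = Ind w' c
     /\ dwrithe n (smooth w c) = dwrithe n (smooth w' c)} ->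
  \sum_(c <- crossings pl) Fterm n w c = 0 ->
  Fpoly n w = Fpoly n w'.
Proof.
move=> p dw H pl0; rewrite !FpolyE.
have pc : perm_eq (crossings w) (crossings pl ++ crossings w').
  by rewrite /crossings -filter_cat; apply: perm_filter.
apply: (sum_perm_cat pc pl0) => c /H[i d]; by rewrite /Fterm i d dw.
Qed.

Lemma wf_perm w w' : perm_eq w w' -> wf_word w -> wf_word w'.
Proof.
move=> p wfw; apply: wf_intro; first exact: closed_word_perm (closed_wf wfw).
by move=> u v; rewrite -!(perm_mem p); apply: wf_same_name.
Qed.

Lemma wf_rot k w : wf_word (rot k w) = wf_word w.
Proof. by apply/idP/idP; apply: wf_perm; rewrite ?perm_rot // perm_sym perm_rot. Qed.

(** Successive changes of base point compose. *)
Lemma rot_rot_ex k j (w : word) : exists m, rot j (rot k w) = rot m w.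
Proof.
have [jw|jw] := leqP j (size w); last first.
  by exists k; rewrite [LHS]rot_oversize // size_rot ltnW.
have [kw|kw] := leqP k (size w); last first.
  by exists j; rewrite (rot_oversize (ltnW kw)).
by rewrite rot_add_mod //; eexists.
Qed.

Lemma smooth_rot k w c : wf_word w -> c \in w -> smooth (rot k w) c = smooth w c.
Proof.
move=> wfw cw; have cr : c \in rot k w by rewrite mem_rot.
have [j s es] := rot_to cr; have [m em] := rot_rot_ex k j w.
have uw := wf_uniq wfw; rewrite em in es.
rewrite /smooth (rot_head uw es) (@rot_head _ j c s) ?rot_uniq //.
by rewrite em.
Qed.

Lemma Ind_chain w c Q z : wf_word w -> c \in crossings w -> chain wt Q z w ->
  Ind w c = gap wt Q c.
Proof.
move=> wfw cc ch; have [uw mw] := closed_wf wfw; rewrite Ind_gap // /gap.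
have d := chain_diff (fun _ _ => erefl) ch (chain_pre wt uw).
have cw : c \in w by move: cc; rewrite mem_crossings => /andP[].
by rewrite !d ?mw //; lia.
Qed.

Lemma Ind_rot k w c : wf_word w -> c \in crossings w ->
  Ind (rot k w) c = Ind w c.
Proof.
move=> wfw cc; rewrite (Ind_gap wfw) //; have cw := closed_wf wfw.
apply: Ind_chain; first by rewrite wf_rot.
  by move: cc; rewrite !mem_crossings mem_rot.
apply: chain_rot (chain_pre _ (wf_uniq wfw)) _; apply: tot0 => //; exact: wt_odd.
Qed.

Lemma dwrithe_rot n k w : wf_word w -> dwrithe n (rot k w) = dwrithe n w.
Proof.
move=> wfw; rewrite !dwritheE ?wf_rot // flat_writhe_rot //; last exact: wt_odd.
exact: closed_wf.
Qed.

Lemma Fpoly_rot n k w : wf_word w -> Fpoly n (rot k w) = Fpoly n w.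
Proof.
move=> wfw; apply: (@eq_Fpoly_extra _ _ _ [::]); rewrite ?perm_rot //.
- exact: dwrithe_rot.
- move=> c cc; rewrite Ind_rot // smooth_rot //.
  by move: cc; rewrite mem_crossings => /andP[].
- by rewrite big_nil.
Qed.

(** * Renaming of the double points *)

Section Rename.

Variable f : nat -> nat.
Hypothesis f_inj : injective f.

Let g v := Visit (f (name v)) (lev v) (rising v).

Let g_inj : injective g.
Proof. by case=> x l r [x' l' r'] [/f_inj -> -> ->]. Qed.

Let wf_g w : wf_word w -> wf_word (map g w).
Proof.
move=> wfw; apply: wf_intro.
  by apply: closed_map (closed_wf wfw) _ _ => // u v _ _; exact: g_inj.
move=> _ _ /mapP[u uw ->] /mapP[v vw ->] /= /f_inj /(wf_same_name wfw uw vw).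
by case=> ->; [left|right].
Qed.

Let dwrithe_g n w : wf_word w -> dwrithe n (map g w) = dwrithe n w.
Proof.
move=> wfw; rewrite !dwritheE ?wf_g // flat_writhe_map //.
- exact: closed_wf.
- by move=> u v _ _; exact: g_inj.
Qed.

Let smooth_g w c : smooth (map g w) (g c) = map g (smooth w c).
Proof.
rewrite /smooth index_map // -map_rot behead_map.
have -> : mate (g c) = g (mate c) by [].
rewrite index_map // -map_take -map_drop -map_rev -map_cat -!map_comp.
apply: eq_map => v /=.
have -> : mate (g v) = g (mate v) by [].
by rewrite !mem_map //; case: ifP.
Qed.

Let Ind_g w c : wf_word w -> c \in crossings w -> Ind (map g w) (g c) = Ind w c.
Proof.
move=> wfw cc; have gc : g c \in crossings (map g w).
  by move: cc; rewrite !mem_crossings mem_map.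
rewrite (Ind_gap (wf_g wfw) gc).
have := chain_pre wt (wf_uniq (wf_g wfw)) => /chain_map ch.
by rewrite (Ind_chain wfw cc ch).
Qed.

Lemma Fpoly_rename n w : wf_word w -> Fpoly n (map g w) = Fpoly n w.
Proof.
move=> wfw; rewrite !FpolyE /crossings filter_map.
apply: (@sum_map_in laurent _ _ g _ (Fterm n (map g w)) (Fterm n w)) => c cc.
have cw : c \in w by move: cc; rewrite mem_filter => /andP[].
have [k [A [B ew]]] := rot_split wfw cw.
have dc := dwrithe_g n (wf_smooth wfw ew).
by rewrite /Fterm smooth_g dc (dwrithe_g n wfw) (Ind_g wfw cc).
Qed.

End Rename.

(** * Local modifications of words *)

(** The word on the right is obtained from the one on the left by keeping the
    core letters in place and replacing pairs x y of consecutive letters outside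
    the core by words s such that r x y s. *)
Inductive patch (core : pred visit) (r : visit -> visit -> word -> Prop) :
  word -> word -> Prop :=
| patch_nil : patch core r [::] [::]
| patch_cons x A A' of core x & patch core r A A' :
    patch core r (x :: A) (x :: A')
| patch_pair x y s A A' of r x y s & ~~ core x & ~~ core y
    & {in s, forall v, ~~ core v} & patch core r A A' :
    patch core r (x :: y :: A) (s ++ A').

Section Patch.

Variables (core : pred visit) (r : visit -> visit -> word -> Prop).

Lemma patch_cat A A' B B' :
  patch core r A A' -> patch core r B B' -> patch core r (A ++ B) (A' ++ B').
Proof.
move=> pA pB; elim: pA => //= [x C C' cx _ IH|x y s C C' rs nx ny ns _ IH].
  exact: patch_cons.
by rewrite -catA; apply: patch_pair.
Qed.

Lemma patch_id A : {in A, forall v, core v} -> patch core r A A.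
Proof.
elim: A => [|x A IH] cA; first exact: patch_nil.
apply: patch_cons; first by apply: cA; rewrite mem_head.
by apply: IH => v vA; apply: cA; rewrite inE vA orbT.
Qed.

Lemma patch_rev A A' : patch core r A A' ->
  patch core (fun x y s => r y x (rev s)) (rev A) (rev A').
Proof.
have id1 r' x : core x -> patch core r' [:: x] [:: x].
  by move=> cx; apply: patch_cons => //; apply: patch_nil.
elim=> [|x C C' cx _ IH|x y s C C' rs nx ny ns _ IH]; first exact: patch_nil.
  rewrite !rev_cons -!cats1.
  elim: IH => //= [|x' D D' cx' _ IH|x' y s D D' rs nx ny ns _ IH]; first exact: id1.
    exact: patch_cons.
  by rewrite -catA; apply: patch_pair.
rewrite rev_cat !rev_cons -!cats1 -catA /=.
elim: IH => //= [|x' D D' cx' _ IH|x' y' s' D D' rs' nx' ny' ns' _ IH].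
- rewrite -[rev s]cats0; apply: patch_pair => //; last exact: patch_nil.
    by rewrite revK.
  by move=> v; rewrite mem_rev; apply: ns.
- exact: patch_cons.
- by rewrite -catA; apply: patch_pair.
Qed.

Lemma patch_mem A A' v : patch core r A A' -> core v -> (v \in A') = (v \in A).
Proof.
move=> pA cv; elim: pA => // [x C C' cx _ IH|x y s C C' rs nx ny ns _ IH].
  by rewrite !inE IH.
rewrite mem_cat !inE IH; case vs: (v \in s); first by have := ns v vs; rewrite cv.
have nc z : ~~ core z -> (v == z) = false by move=> nz; apply: contraNF nz => /eqP<-.
by rewrite !nc.
Qed.

Lemma patch_split_core A c B W : core c -> patch core r (A ++ c :: B) W ->
  exists A' B', [/\ W = A' ++ c :: B', patch core r A A' & patch core r B B'].
Proof.
move=> cc; move eV: (A ++ c :: B) => V pV.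
elim: pV A eV => [|x C C' cx pC IH|x y s C C' rs nx ny ns pC IH] A.
- by case: A.
- case: A => [|a A] /= [ex eC].
    by exists [::], C'; rewrite ex eC; split => //; apply: patch_nil.
  have [A' [B' [-> pA pB]]] := IH _ eC.
  by exists (x :: A'), B'; rewrite ex; split => //; apply: patch_cons.
- case: A => [|a [|a' A]] /=.
  + by case=> ex _; rewrite -ex cc in nx.
  + by case=> _ ey _; rewrite -ey cc in ny.
  case=> -> -> /IH[A' [B' [-> pA pB]]].
  by exists (s ++ A'), B'; rewrite catA; split => //; apply: patch_pair.
Qed.

Lemma patch_split_pair a W W' : patch core r W W' -> a \in W -> ~~ core a ->
  exists A x y B A' s B',
    [/\ W = A ++ x :: y :: B, W' = A' ++ s ++ B', r x y s & a = x \/ a = y]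
    /\ (patch core r A A' /\ patch core r B B').
Proof.
move=> pW + na; elim: pW => // [x C C' cx pC IH|x y s C C' rs nx ny ns pC IH].
  rewrite inE; case: eqP => [e|_ /=]; first by rewrite e cx in na.
  move=> /IH[A [x' [y [B [A' [s [B' [[-> -> rs ea] [pA pB]]]]]]]]].
  by exists (x :: A), x', y, B, (x :: A'), s, B'; do 2 split => //; apply: patch_cons.
rewrite !inE; case: eqP => [ea _|_ /=].
  exists [::], x, y, C, [::], s, C'; split; last by split => //; apply: patch_nil.
  by split => //; left.
case: eqP => [ea _|_ /=].
  exists [::], x, y, C, [::], s, C'; split; last by split => //; apply: patch_nil.
  by split => //; right.
move=> /IH[A [x' [y' [B [A' [s' [B' [[-> -> rs' ea] [pA pB]]]]]]]]].
exists (x :: y :: A), x', y', B, (s ++ A'), s', B'; rewrite -!catA.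
by do 2 split => //; apply: patch_pair.
Qed.

(** At a double point c in the core, both words can be cut into the two paths of
    the smoothing at c, and the patch restricts to each of them. *)
Lemma patch_rot_split w w' c : closed_word w -> patch core r w w' ->
  c \in w -> core c -> core (mate c) ->
  exists k k' A B A' B', [/\ rot k w = c :: A ++ mate c :: B,
    rot k' w' = c :: A' ++ mate c :: B', patch core r A A' & patch core r B B'].
Proof.
move=> [uw mw] pw cw cc cmc; have mcw := mw _ cw.
have [w1 [w2 ew]] : exists w1 w2, w = w1 ++ c :: w2.
  by case/splitPr: cw => w1 w2; exists w1, w2.
move: pw mcw; rewrite ew => /(patch_split_core cc)[w1' [w2' [-> p1 p2]]].
rewrite mem_cat inE (negPf (mate_neq c)) /= orbC -mem_cat => mc.
have [A [B eAB]] : exists A B, w2 ++ w1 = A ++ mate c :: B.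
  by case/splitPr: mc => A B; exists A, B.
have := patch_cat p2 p1; rewrite eAB => /(patch_split_core cmc)[A' [B' [e' pA pB]]].
exists (size w1), (size w1'), A, B, A', B'.
by rewrite !rot_size_cat /= eAB e'.
Qed.

End Patch.

Lemma patch_impl core core' (r r' : visit -> visit -> word -> Prop) A A' :
  {in A, core =1 core'} ->
  (forall x y s, x \in A -> y \in A -> r x y s ->
     r' x y s /\ {in s, forall v, ~~ core' v}) ->
  patch core r A A' -> patch core' r' A A'.
Proof.
move=> ec er p; elim: p ec er => [|x C C' cx _ IH|x y s C C' rs nx ny ns _ IH] ec er.
- exact: patch_nil.
- apply: patch_cons; first by rewrite -ec ?mem_head.
  apply: IH => [v vC|x' y' s' xC yC]; first by apply: ec; rewrite inE vC orbT.
  by apply: er; rewrite inE ?xC ?yC orbT.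
- have [||rs' ns'] := er x y s _ _ rs; rewrite ?inE ?eqxx ?orbT //.
  apply: patch_pair => //; rewrite -?ec ?inE ?eqxx ?orbT //.
  apply: IH => [v vC|x' y' s' xC yC]; first by apply: ec; rewrite !inE vC !orbT.
  by apply: er; rewrite !inE ?xC ?yC !orbT.
Qed.

(** Deletion of two consecutive letters exchanged by pi. *)
Definition del_rule (pi : visit -> visit) (x y : visit) (s : word) : Prop :=
  [/\ y = pi x, x = pi y & s = [::]].

(** Exchange of two consecutive letters x and y exchanged by pi; sigma is 1 on
    the first one and -1 on the second one. *)
Definition flip_rule (sigma : visit -> int) (pi : visit -> visit)
    (x y : visit) (s : word) : Prop :=
  [/\ y = pi x, x = pi y, s = [:: y; x], sigma x = 1 & sigma y = -1].

(** Deletion of all the letters of pl, in consecutive pairs exchanged by pi. *)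
Definition del (pl : word) pi := patch (fun v => v \notin pl) (del_rule pi).
(** Exchange of consecutive letters wherever sigma does not vanish. *)
Definition flip sigma pi :=
  patch (fun v => sigma v == 0) (flip_rule sigma pi).

(** Deleting pairs of opposite weights does not affect the running sums at the
    other letters. *)
Lemma chain_del e Q Q' z z' pl pi A A' : del pl pi A A' ->
  {in A, forall v, v \in pl -> e (pi v) = - e v} ->
  chain e Q z A -> chain e Q' z' A' ->
  [/\ {in A, forall v, v \notin pl -> Q' v = Q v + (z' - z)},
      {in A, forall v, v \in pl -> Q (pi v) = Q v + e v}
    & tot e A = tot e A'].
Proof.
move=> p; elim: p z z' => [|x C C' cx _ IH|x y s C C' [ey ex ->] nx ny _ _ IH] z z' op.
- by move=> _ _; split => //; rewrite !tot_nil.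
- move=> /= [Qx ch] [Qx' ch'].
  have op' : {in C, forall v, v \in pl -> e (pi v) = - e v}.
    by move=> v vC; apply: op; rewrite inE vC orbT.
  have [h1 h2 h3] := IH _ _ op' ch ch'; rewrite !tot_cons h3; split => // v.
    rewrite inE => /predU1P[-> _|vC nv]; first by rewrite Qx Qx'; lia.
    by rewrite h1 //; lia.
  by rewrite inE => /predU1P[->|]; [rewrite (negPf cx)|apply: h2].
- rewrite !negbK in nx ny.
  move=> /= [Qx [Qy ch]] ch'.
  have op' : {in C, forall v, v \in pl -> e (pi v) = - e v}.
    by move=> v vC; apply: op; rewrite !inE vC !orbT.
  have eyx : e y = - e x by rewrite ey; apply: op; rewrite ?mem_head.
  have [h1 h2 h3] := IH _ _ op' ch ch'; rewrite !tot_cons h3; split => [v|v|].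
  + rewrite !inE => /predU1P[->|/predU1P[->|vC nv]]; rewrite ?nx ?ny //.
    by rewrite h1 //; lia.
  + rewrite !inE => /predU1P[-> _|/predU1P[-> _|vC nv]]; last exact: h2.
      by rewrite -ey Qx Qy.
    by rewrite -ex Qx Qy eyx; lia.
  + by rewrite /= eyx; lia.
Qed.

Lemma flip_perm (sigma : visit -> int) pi A A' : flip sigma pi A A' -> perm_eq A A'.
Proof.
elim=> [|x C C' _ _ IH|x y s C C' [_ _ -> _ _] _ _ _ _ IH] //.
  by rewrite perm_cons.
by rewrite -[x :: y :: C]/([:: x; y] ++ C) perm_cat // perm_swap2.
Qed.

Lemma flip_sym (sigma : visit -> int) pi A A' : flip sigma pi A A' ->
  flip (fun v => - sigma v) pi A' A.
Proof.
elim=> [|x C C' cx _ IH|x y s C C' [ey ex -> sx sy] nx ny _ _ IH].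
- exact: patch_nil.
- by apply: patch_cons => //; rewrite oppr_eq0.
- apply: (@patch_pair _ _ y x [:: x; y]); rewrite ?oppr_eq0 //.
    by split => //; rewrite ?sx ?sy.
  by move=> v; rewrite !inE => /orP[]/eqP->; rewrite oppr_eq0.
Qed.

Lemma flip_rev (sigma : visit -> int) pi A A' : flip sigma pi A A' ->
  flip (fun v => - sigma v) pi (rev A) (rev A').
Proof.
move=> /patch_rev; apply: patch_impl => [v _|x y s _ _]; first by rewrite oppr_eq0.
case=> ex ey es sy sx; have -> : s = [:: y; x] by rewrite -[s]revK es.
split; first by split; rewrite ?sx ?sy.
by move=> v; rewrite !inE => /orP[]/eqP->; rewrite oppr_eq0 ?sx ?sy.
Qed.

Lemma flip_sign (sigma : visit -> int) pi A A' v : flip sigma pi A A' -> v \in A ->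
  [\/ sigma v = 0, sigma v = 1 | sigma v = -1].
Proof.
elim=> // [x C C' cx _ IH|x y s C C' [ey ex -> sx sy] _ _ _ _ IH].
  by rewrite inE => /predU1P[->|//]; constructor 1; apply/eqP.
by rewrite !inE => /predU1P[->|/predU1P[->|//]]; [constructor 2|constructor 3].
Qed.

Lemma flip_partner (sigma : visit -> int) pi A A' v : flip sigma pi A A' -> v \in A ->
  sigma v != 0 -> [/\ pi v \in A, pi (pi v) = v & sigma (pi v) = - sigma v].
Proof.
elim=> // [x C C' cx _ IH|x y s C C' [ey ex -> sx sy] _ _ _ _ IH].
  rewrite inE => /predU1P[->|vC nv]; first by rewrite cx.
  by have [h ? ?] := IH vC nv; split => //; rewrite inE h orbT.
rewrite !inE => /predU1P[->|/predU1P[->|vC nv]].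
- by rewrite -ey -ex sx sy eqxx orbT.
- by rewrite -ex -ey sx sy eqxx opprK.
by have [h ? ?] := IH vC nv; split => //; rewrite h !orbT.
Qed.

Lemma del_rev pl pi A A' : del pl pi A A' -> del pl pi (rev A) (rev A').
Proof.
move=> /patch_rev; apply: patch_impl => // x y s _ _ [ex ey es].
have -> : s = [::] by rewrite -[s]revK es.
by split.
Qed.

Lemma del_chord v X Z : {in X ++ Z, forall u, u \notin [:: v; mate v]} ->
  del [:: v; mate v] mate (X ++ [:: v; mate v] ++ Z) (X ++ Z).
Proof.
move=> nc; apply: patch_cat.
  by apply: patch_id => u uw; apply: nc; rewrite mem_cat uw.
apply: (@patch_pair _ _ v (mate v) [::]).
- by split; rewrite ?mateK.
- by rewrite negbK inE eqxx.
- by rewrite negbK !inE eqxx orbT.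
- by [].
by apply: patch_id => u uw; apply: nc; rewrite mem_cat uw orbT.
Qed.

Lemma del_partner pl pi A A' v : del pl pi A A' -> v \in A ->
  v \in pl -> pi v \in A.
Proof.
elim=> // [x C C' cx _ IH|x y s C C' [ey ex ->] _ _ _ _ IH].
  rewrite inE => /predU1P[->|vC nv]; first by rewrite (negPf cx).
  by rewrite inE IH ?orbT.
rewrite !inE => /predU1P[->|/predU1P[->|vC nv]].
- by rewrite -ey eqxx orbT.
- by rewrite -ex eqxx.
by rewrite IH ?orbT.
Qed.

(** A letter of a flipped pair moves past its partner, so its running sum
    changes by the weight of the partner, up to the change of starting value. *)
Lemma chain_flip e Q Q' z z' (sigma : visit -> int) pi A A' : flip sigma pi A A' ->
  chain e Q z A -> chain e Q' z' A' ->
  {in A, forall v, Q' v = Q v + (z' - z) + sigma v * e (pi v)}.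
Proof.
move=> p; elim: p z z' => [|x C C' cx _ IH|x y s C C' [ey ex -> sx sy] _ _ _ _ IH] z z' //.
- move=> /= [Qx ch] [Qx' ch'] v; rewrite inE => /predU1P[->|vC].
    by rewrite (eqP cx) mul0r Qx Qx'; lia.
  by rewrite (IH _ _ ch ch') //; lia.
- move=> /= [Qx [Qy ch]] [Qy' [Qx' ch']] v.
  rewrite !inE => /predU1P[->|/predU1P[->|vC]].
  + by rewrite -ey sx mul1r Qx Qx'; lia.
  + by rewrite -ex sy mulN1r Qy Qy'; lia.
  by rewrite (IH _ _ ch ch') //; lia.
Qed.

(** The case of flipped pairs of total weight 0 whose weights are negated by
    the flip: the two letters of such a pair exchange their running sums, again up to
    the change of starting value. *)
Lemma chain_flip0 e e' Q Q' z z' (sigma : visit -> int) pi A A' : flip sigma pi A A' ->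
  {in A, forall v, sigma v = 0 -> e' v = e v} ->
  {in A, forall v, sigma v != 0 -> e (pi v) = - e v /\ e' v = - e v} ->
  chain e Q z A -> chain e' Q' z' A' ->
  [/\ {in A, forall v, sigma v = 0 -> Q' v = Q v + (z' - z)},
      {in A, forall v, sigma v != 0 -> Q' (pi v) = Q v + (z' - z)},
      {in A, forall v, sigma v != 0 -> Q (pi v) = Q v + e v}
    & tot e A = tot e' A'].
Proof.
move=> p.
elim: p z z' => [|x C C' cx _ IH|x y s C C' [ey ex -> sx sy] nx ny _ _ IH] z z' ec en.
- by move=> _ _; split => //; rewrite !tot_nil.
- move=> /= [Qx ch] [Qx' ch'].
  have exx : e' x = e x by apply: ec; rewrite ?mem_head //; apply/eqP.
  have ec' : {in C, forall v, sigma v = 0 -> e' v = e v}.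
    by move=> v vC; apply: ec; rewrite inE vC orbT.
  have en' : {in C, forall v, sigma v != 0 -> e (pi v) = - e v /\ e' v = - e v}.
    by move=> v vC; apply: en; rewrite inE vC orbT.
  have [h1 h2 h3 h4] := IH _ _ ec' en' ch ch'; rewrite !tot_cons h4 exx; split => // v.
  + rewrite inE => /predU1P[-> _|vC nv]; first by rewrite Qx Qx'; lia.
    by rewrite h1 //; lia.
  + rewrite inE => /predU1P[->|vC nv]; first by rewrite cx.
    by rewrite h2 //; lia.
  + by rewrite inE => /predU1P[->|]; [rewrite cx|apply: h3].
- move=> /= [Qx [Qy ch]] [Qy' [Qx' ch']].
  have yC : y \in x :: y :: C by rewrite !inE eqxx orbT.
  have [eyx e'x] := en x (mem_head _ _) nx; have [_ e'y] := en y yC ny.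
  rewrite -ey in eyx.
  have ec' : {in C, forall v, sigma v = 0 -> e' v = e v}.
    by move=> v vC; apply: ec; rewrite !inE vC !orbT.
  have en' : {in C, forall v, sigma v != 0 -> e (pi v) = - e v /\ e' v = - e v}.
    by move=> v vC; apply: en; rewrite !inE vC !orbT.
  have [h1 h2 h3 h4] := IH _ _ ec' en' ch ch'; split => [v|v|v|].
  + rewrite !inE => /predU1P[->|/predU1P[->|vC nv]]; rewrite ?sx ?sy //.
    by rewrite h1 //; lia.
  + rewrite !inE => /predU1P[->|/predU1P[->|vC nv]].
    * by rewrite -ey => _; lia.
    * by rewrite -ex => _; lia.
    by rewrite h2 //; lia.
  + rewrite !inE => /predU1P[->|/predU1P[->|vC nv]]; last exact: h3.
    * by rewrite -ey => _; lia.
    * by rewrite -ex => _; lia.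
  by rewrite /= !tot_cons h4; rewrite e'x e'y eyx; ring.
Qed.

(** The dwrithes of two words agree if the letters p1 of the first one and p2 of
    the second one contribute equally and the remaining letters K have the same
    weights and running sums. *)
Lemma flat_writhe_compare n e1 e2 Q1 Q2 z1 z2 u1 u2 p1 p2 K :
  closed_word u1 -> closed_word u2 -> chain e1 Q1 z1 u1 -> chain e2 Q2 z2 u2 ->
  perm_eq u1 (p1 ++ K) -> perm_eq u2 (p2 ++ K) -> {in K, forall v, mate v \in K} ->
  {in K, e1 =1 e2} -> {in K, Q1 =1 Q2} ->
  \sum_(v <- p1 | gap e1 Q1 v == n) e1 v = \sum_(v <- p2 | gap e2 Q2 v == n) e2 v ->
  flat_writhe n e1 u1 = flat_writhe n e2 u2.
Proof.
move=> c1 c2 ch1 ch2 pm1 pm2 mK eK QK ep.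
rewrite (flat_writhe_chain n c1 ch1) (flat_writhe_chain n c2 ch2).
rewrite (perm_big _ pm1) (perm_big _ pm2) !big_cat /= ep; congr (_ + _).
rewrite big_seq_cond [RHS]big_seq_cond; apply: eq_big => v.
  by case vK: (v \in K) => //=; rewrite /gap !QK ?eK // mK.
by case/andP=> /eK.
Qed.

Lemma sum_odd0 (I : eqType) (s : seq I) (h : I -> I) (P : pred I) (F : I -> int) :
  perm_eq (map h s) s -> {in s, forall i, P (h i) = P i /\ F (h i) = - F i} ->
  \sum_(i <- s | P i) F i = 0.
Proof.
move=> p H; have : \sum_(i <- s | P i) F i = - \sum_(i <- s | P i) F i; last by lia.
rewrite -[in LHS](perm_big _ p) /= big_map -sumrN big_seq_cond [RHS]big_seq_cond.
apply: eq_big => i; first by case si: (i \in s) => //=; case: (H i si).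
by case/andP=> /H[].
Qed.

(** Two consecutive letters of opposite weights, whose mates are also
    consecutive, have the same gap, so the contributions of the deleted letters
    cancel in pairs. *)
Lemma flat_writhe_del n e pl pi u u' : closed_word u -> closed_word u' ->
  perm_eq u (pl ++ u') -> del pl pi u u' -> perm_eq (map pi pl) pl ->
  {in pl, forall v, e (pi v) = - e v /\ pi (mate v) = mate (pi v)} ->
  {in pl, forall v, mate v \in pl /\ e (mate v) = - e v} ->
  flat_writhe n e u = flat_writhe n e u'.
Proof.
move=> cu cu' pu du ppl ep mp; have [uu mu] := cu; have [uu' mu'] := cu'.
have op : {in u, forall v, v \in pl -> e (pi v) = - e v} by move=> v _ /ep[].
have [h1 h2 _] := chain_del du op (chain_pre e uu) (chain_pre e uu').
have plu v : v \in pl -> v \in u by rewrite (perm_mem pu) mem_cat => ->.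
have u'u v : v \in u' -> v \in u by rewrite (perm_mem pu) mem_cat orbC => ->.
have u'pl v : v \in u' -> v \notin pl.
  by move=> vu; have := uu; rewrite (perm_uniq pu) cat_uniq => /and3P[_ /hasPn /(_ v vu)].
apply: (@flat_writhe_compare n e e _ _ _ _ u u' pl [::] u' cu cu'
  (chain_pre e uu) (chain_pre e uu') pu) => //.
  by move=> v vu; rewrite h1 ?u'u ?u'pl //; lia.
rewrite big_nil; apply: (sum_odd0 ppl) => v vp; have [epv epi] := ep v vp.
have [mvp emv] := mp v vp.
split => //; congr (_ == _); rewrite /gap -epi !h2 ?plu // epv emv; lia.
Qed.

(** Under the balance condition the running sums at v and at mate v change by
    the same amount, and the gap of v is unchanged. *)
Lemma gap_flip e (sigma : visit -> int) pi u u' : closed_word u -> flip sigma pi u u' ->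
  {in u, forall v, e v != 0 ->
     sigma v * e (pi v) = sigma (mate v) * e (pi (mate v))} ->
  {in u, forall v, e v != 0 -> gap e (pre e u') v = gap e (pre e u) v}.
Proof.
move=> cu fu H v vu ev; have [uu mu] := cu.
have uu' : uniq u' by rewrite -(perm_uniq (flip_perm fu)).
have d := chain_flip fu (chain_pre e uu) (chain_pre e uu').
by rewrite /gap !d ?mu // -H //; lia.
Qed.

Lemma flat_writhe_flip n e (sigma : visit -> int) pi u u' :
  closed_word u -> flip sigma pi u u' ->
  {in u, forall v, e v != 0 ->
     sigma v * e (pi v) = sigma (mate v) * e (pi (mate v))} ->
  flat_writhe n e u = flat_writhe n e u'.
Proof.
move=> cu fu H; have g := gap_flip cu fu H; have pu := flip_perm fu.
rewrite /flat_writhe -(perm_big _ pu) /= big_mkcond [RHS]big_mkcond big_seq [RHS]big_seq.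
apply: eq_bigr => v vu; have [->|/(g v vu) -> //] := eqVneq (e v) 0.
by rewrite !if_same.
Qed.

(** * Dwrithes of smoothings at a corner of a triangle *)

(** Four letters forming two chords: the gaps of mate b and mate d are opposite
    to those of b and d. *)
Lemma sum_chords n (E Q : visit -> int) b d : (forall v, E (mate v) = - E v) ->
  \sum_(v <- [:: b; d; mate b; mate d] | gap E Q v == n) E v
  = (if gap E Q b == n then E b else 0) - (if - gap E Q b == n then E b else 0)
  + ((if gap E Q d == n then E d else 0) - (if - gap E Q d == n then E d else 0)).
Proof.
move=> oE; have g v : gap E Q (mate v) = - gap E Q v by rewrite /gap mateK oE; lia.
rewrite big_mkcond !big_cons big_nil !g !oE /=.
by case: (gap E Q b == n); case: (- gap E Q b == n); case: (gap E Q d == n);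
   case: (- gap E Q d == n); lia.
Qed.

(** In the smoothing at a crossing of the triangle, the two strands through that
    crossing are reconnected into two arcs, and the letters b and d of the two
    other crossings each move from one arc to the other. If the smoothed crossing
    comes first on both strands, b and d are cyclically consecutive in both words
    and their contributions cancel in each. If it comes first on one strand and
    last on the other, b in the first word plays the role of d in the second one
    and conversely. *)
Lemma flat_writhe_cap n E E' (sigma : visit -> int) pi X X' W W' b d u1 u2 :
  closed_word u1 ->
  (u1 = b :: X ++ W ++ [:: d] /\ u2 = X' ++ [:: d, b & W']
   \/ u1 = b :: X ++ d :: W /\ u2 = X' ++ b :: W' ++ [:: d]) ->
  flip sigma pi X X' -> flip (fun v => - sigma v) pi W W' ->
  (forall v, E (mate v) = - E v) -> (forall v, E' (mate v) = - E' v) ->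
  {in X ++ W, forall v, sigma v = 0 -> E' v = E v /\ sigma (mate v) = 0} ->
  [/\ E d = - E b, E' b = - E b & E' d = E b] ->
  {in X ++ W, forall v, sigma v != 0 -> v = mate b \/ v = mate d} ->
  pi (mate b) = mate d -> pi (mate d) = mate b ->
  uniq [:: b; d; mate b; mate d] ->
  {in [:: b; d; mate b; mate d], forall v, sigma v != 0} ->
  flat_writhe n E u1 = flat_writhe n E' u2.
Proof.
move=> cu sh fX fW oE oE' core [Ed E'b E'd] nc pb pd upl npl.
have [uu mu] := cu; pose pl := [:: b; d; mate b; mate d].
have pu : perm_eq u1 (b :: d :: X ++ W).
  case: sh => -[-> _]; rewrite perm_cons.
    by rewrite catA perm_catC.
  by rewrite perm_catC /= perm_cons perm_catC.
have pXW : perm_eq (X' ++ W') (X ++ W).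
  by rewrite perm_sym; apply: perm_cat; [apply: flip_perm fX|apply: flip_perm fW].
have pu' : perm_eq u2 (b :: d :: X ++ W).
  apply: (@perm_trans _ (b :: d :: X' ++ W')); last by rewrite !perm_cons.
  by case: sh => -[_ ->]; apply/permP => p; rewrite /= !count_cat /= ?count_cat /=; lia.
have mXW v : v \in X ++ W -> v \in u1 by move=> h; rewrite (perm_mem pu) !inE h !orbT.
pose K := [seq v <- X ++ W | sigma v == 0].
have uXW : uniq (X ++ W) by move: uu; rewrite (perm_uniq pu) /= => /and3P[].
have pK : perm_eq (b :: d :: X ++ W) (pl ++ K).
  apply: uniq_perm; first by rewrite -(perm_uniq pu).
    rewrite cat_uniq upl filter_uniq // andbT /=.
    by apply/hasPn => v; rewrite mem_filter => /andP[s0 _]; apply/negP => /npl; rewrite s0.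
  move=> v; rewrite mem_cat mem_filter; apply/idP/idP.
    rewrite !inE => /or3P[->//|->|vXW]; first by rewrite orbT.
    case: (eqVneq (sigma v) 0) => [_|/(nc v vXW)[]->]; rewrite ?eqxx ?vXW ?orbT //.
  rewrite -(perm_mem pu) => /orP[|/andP[_ /mXW //]].
  have bu : b \in u1 by rewrite (perm_mem pu) !inE eqxx.
  have du : d \in u1 by rewrite (perm_mem pu) !inE eqxx orbT.
  by rewrite !inE => /or4P[]/eqP->; rewrite ?mu.
have cu' : closed_word u2.
  by apply: closed_word_perm cu; rewrite (perm_trans pu) // perm_sym.
have mK : {in K, forall v, mate v \in K}.
  move=> v; rewrite !mem_filter => /andP[/eqP s0 vXW].
  have [_ ms0] := core v vXW s0; rewrite ms0 eqxx /=.
  have := mu v (mXW v vXW); rewrite (perm_mem pu) !inE.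
  by case/or3P => // /eqP e; have := npl (mate v); rewrite ms0 e !inE eqxx ?orbT => /(_ isT).
have t0 : tot E u1 = 0 by apply: tot0 => // v _.
have eC (V : word) : {subset V <= X ++ W} -> {in V, forall v, sigma v = 0 -> E' v = E v}.
  by move=> sV v vV s0; case: (core v (sV v vV) s0).
have eN (V : word) : {subset V <= X ++ W} ->
    {in V, forall v, sigma v != 0 -> E (pi v) = - E v /\ E' v = - E v}.
  move=> sV v vV /(nc v (sV v vV))[]->; rewrite ?pb ?pd !oE !oE' Ed ?E'b ?E'd; split; ring.
have sX : {subset X <= X ++ W} by move=> v; rewrite mem_cat => ->.
have sW : {subset W <= X ++ W} by move=> v; rewrite mem_cat orbC => ->.
have eNW : {in W, forall v, - sigma v = 0 -> E' v = E v}.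
  by move=> v vW /eqP; rewrite oppr_eq0 => /eqP; exact: (eC W sW v vW).
have eNW' : {in W, forall v, - sigma v != 0 -> E (pi v) = - E v /\ E' v = - E v}.
  by move=> v vW; rewrite oppr_eq0; exact: (eN W sW v vW).
have ch := chain_pre E uu; have ch' := chain_pre E' (proj1 cu').
(* The second system of running sums starts from E b, so that it agrees with the
   first one on the core. *)
set Q := pre E u1 in ch; set Q0 := pre E' u2 in ch'.
have {ch'} := chain_shift (E b) ch'; rewrite addr0; set Q' := fun v => _ => ch'.
have nmb : sigma (mate b) != 0 by apply: npl; rewrite !inE eqxx ?orbT.
have nmd : sigma (mate d) != 0 by apply: npl; rewrite !inE eqxx ?orbT.
have dmb : d != mate b by move: upl; rewrite /= !inE !negb_or => /and3P[_ /andP[]].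
have bmd : b != mate d by move: upl; rewrite /= !inE !negb_or => /andP[/and3P[]].
have mbXW : mate b \in X ++ W.
  have := mu b; rewrite !(perm_mem pu) !inE eqxx => /(_ isT).
  by rewrite (negPf (mate_neq b)) eq_sym (negPf dmb).
have mdXW : mate d \in X ++ W.
  have := mu d; rewrite !(perm_mem pu) !inE eqxx orbT => /(_ isT).
  by rewrite (negPf (mate_neq d)) eq_sym (negPf bmd).
have key : [/\ {in X ++ W, forall v, sigma v = 0 -> Q' v = Q v},
     {in X ++ W, forall v, sigma v != 0 -> Q' (pi v) = Q v},
     {in X ++ W, forall v, sigma v != 0 -> Q (pi v) = Q v + E v} &
     (Q d = Q b + E b /\ Q' b = Q' d + E b) \/ 
     (Q' d = Q b /\ Q' b = Q d)].
  case: sh => -[e1 e2].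
  - move: ch ch' t0; rewrite e1 e2 /= => -[Qb /chain_cat[cX /chain_cat[cW [Qd _]]]].
    move=> /chain_cat[cX' /= [Q'd [Q'b cW']]]; rewrite !(tot_cons, tot_cat, tot_nil) => t0.
    have [a1 a2 a3 a4] := chain_flip0 fX (eC _ sX) (eN _ sX) cX cX'.
    have [b1 b2 b3 b4] := chain_flip0 fW eNW eNW' cW cW'.
    split => [v|v|v|]; rewrite ?mem_cat.
    + case/orP => [vX s0|vW s0]; first by rewrite a1 //; ring.
      by rewrite b1 ?s0 ?oppr0 // ?E'd E'b a4 ?Ed; ring.
    + case/orP => [vX s0|vW s0]; first by rewrite a2 //; ring.
      by rewrite b2 ?oppr_eq0 // ?E'd E'b a4 ?Ed; ring.
    + case/orP => [vX s0|vW s0]; first exact: a3.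
      by apply: b3; rewrite ?oppr_eq0.
    + by left; split; [clear -Qb Qd t0 Ed; lia|rewrite Q'b Q'd E'd].
  - move: ch ch' t0; rewrite e1 e2 /= => -[Qb /chain_cat[cX /= [Qd cW]]].
    move=> /chain_cat[cX' /= [Q'b /chain_cat[cW' [Q'd _]]]].
    rewrite !(tot_cons, tot_cat, tot_nil) => t0.
    have [a1 a2 a3 a4] := chain_flip0 fX (eC _ sX) (eN _ sX) cX cX'.
    have [b1 b2 b3 b4] := chain_flip0 fW eNW eNW' cW cW'.
    split => [v|v|v|]; rewrite ?mem_cat.
    + case/orP => [vX s0|vW s0]; first by rewrite a1 //; ring.
      by rewrite b1 ?s0 ?oppr0 // ?E'd E'b a4 ?Ed; ring.
    + case/orP => [vX s0|vW s0]; first by rewrite a2 //; ring.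
      by rewrite b2 ?oppr_eq0 // ?E'd E'b a4 ?Ed; ring.
    + case/orP => [vX s0|vW s0]; first exact: a3.
      by apply: b3; rewrite ?oppr_eq0.
    + right; split; last by rewrite Q'b Qd a4 add0r.
      by clear -Qb Q'd t0 Ed E'b a4 b4; lia.
have [k1 k2 k3 k4] := key.
apply: (flat_writhe_compare cu cu' ch ch' (perm_trans pu pK) (perm_trans pu' pK) mK).
- by move=> v; rewrite mem_filter => /andP[/eqP s0 vXW]; case: (core v vXW s0).
- by move=> v; rewrite mem_filter => /andP[/eqP s0 vXW]; rewrite k1.
have q1 := k2 _ mbXW nmb; have q2 := k2 _ mdXW nmd; have q3 := k3 _ mbXW nmb.
have q4 := k3 _ mdXW nmd; rewrite pb oE in q1 q3; rewrite pd oE in q2 q4.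
rewrite !sum_chords // Ed E'b E'd.
case: k4 => -[l1 l2].
  have -> : gap E Q d = gap E Q b by rewrite /gap; clear -l1 l2 q1 q2 q3 q4 Ed E'b E'd; lia.
  have -> : gap E' Q' d = gap E' Q' b by rewrite /gap; clear -l1 l2 q1 q2 q3 q4 Ed E'b E'd; lia.
  by case: (gap E Q b == n); case: (- gap E Q b == n); case: (gap E' Q' b == n);
     case: (- gap E' Q' b == n); ring.
have -> : gap E' Q' d = gap E Q b by rewrite /gap; clear -l1 l2 q1 q2 q3 q4 Ed E'b E'd; lia.
have -> : gap E' Q' b = gap E Q d by rewrite /gap; clear -l1 l2 q1 q2 q3 q4 Ed E'b E'd; lia.
by case: (gap E Q b == n); case: (- gap E Q b == n); case: (gap E Q d == n);
   case: (- gap E Q d == n); ring.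
Qed.

(** * Third moves *)

(** The six visits involved in a third move, as seen from one of them, a: the
    partner pi v is the other visit of the strand containing v. *)
Definition hexagon (pi : visit -> visit) (a : visit) : word :=
  [:: a; mate a; pi a; pi (mate a); mate (pi a); mate (pi (mate a))].

(** What the invariance uses of a third move: consecutive letters exchanged by pi
    are swapped, the swapped letters form a single hexagon under mate and pi, and
    the changes of the running sums at a classical visit and at its mate balance.
    At a virtual visit the balance may fail, but nothing depends on its gap. *)
Definition third_move (sigma : visit -> int) (pi : visit -> visit) (w w' : word) : Prop :=
  flip sigma pi w w' /\
  {in w, forall a, sigma a != 0 ->
    [/\ uniq (hexagon pi a), forall v, (sigma v != 0) = (v \in hexagon pi a),
        pi (mate (pi a)) = mate (pi (mate a))
      & wt a != 0 -> sigma a * wt (pi a) = sigma (mate a) * wt (pi (mate a))]}.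

(** 1 on the path A, whose orientation is kept by a smoothing, and -1 on the
    reversed path. *)
Definition side (A : word) (v : visit) : int := if v \in A then 1 else -1.

Lemma swtE A v : swt A v = side A v * side A (mate v) * wt v.
Proof. by rewrite /swt /side; case: (v \in A); case: (mate v \in A) => /=; ring. Qed.

Lemma eq_swt A A' v : (v \in A) = (v \in A') -> (mate v \in A) = (mate v \in A') ->
  swt A v = swt A' v.
Proof. by rewrite /swt => -> ->. Qed.

(** The crossings outside the triangle. *)
Section ThirdMove.

Variables (sigma : visit -> int) (pi : visit -> visit) (w w' : word).
Hypotheses (wfw : wf_word w) (tm : third_move sigma pi w w').

Let fw : flip sigma pi w w'. Proof. by case: tm. Qed.
Let cw : closed_word w. Proof. exact: closed_wf. Qed.

Lemma third_wf : wf_word w'.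
Proof. exact: wf_perm (flip_perm fw) wfw. Qed.

Lemma third_core v : v \in w -> sigma v = 0 -> sigma (mate v) = 0.
Proof.
move=> vw s0; apply/eqP; apply: contraT => ns; have mvw := wf_mem_mate wfw vw.
have [_ h _ _] := (proj2 tm) _ mvw ns.
by have := h v; rewrite s0 eqxx /hexagon mateK !inE eqxx orbT.
Qed.

Lemma third_balance : {in w, forall v, wt v != 0 ->
  sigma v * wt (pi v) = sigma (mate v) * wt (pi (mate v))}.
Proof.
move=> v vw wv; have [s0|ns] := eqVneq (sigma v) 0.
  by rewrite s0 third_core // !mul0r.
by have [_ _ _ ->] := (proj2 tm) v vw ns.
Qed.

Lemma third_dwrithe n : dwrithe n w = dwrithe n w'.
Proof.
rewrite !dwritheE ?third_wf //.
exact: flat_writhe_flip cw fw third_balance.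
Qed.

Lemma third_crossings : perm_eq (crossings w) (crossings w').
Proof. exact: perm_filter (flip_perm fw). Qed.

Lemma third_Ind c : c \in crossings w -> Ind w c = Ind w' c.
Proof.
move=> cc; rewrite !Ind_gap ?third_wf -?(perm_mem third_crossings) //.
move: cc; rewrite mem_crossings => /andP[/eqP lc cw0].
rewrite (gap_flip cw fw third_balance) // wt_sgn // /sgn.
by case: (rising c).
Qed.

Lemma smooth_third_core n c : c \in w -> sigma c = 0 ->
  dwrithe n (smooth w c) = dwrithe n (smooth w' c).
Proof.
move=> cin s0; have sm0 := third_core cin s0.
have [||k [k' [A [B [A' [B' [ew ew' fA fB]]]]]]] := patch_rot_split cw fw cin.
- by rewrite s0.
- by rewrite sm0.
rewrite (dwrithe_smooth wfw ew) (dwrithe_smooth third_wf ew').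
have cu := smooth_closed wfw ew; have [uu mu] := cu.
have inw := smooth_mem_sub ew; have pA := flip_perm fA.
have sA : {in A ++ rev B, forall v, sigma v != 0 -> (pi v \in A) = (v \in A)}.
  move=> v vu nv; have [vA|vA] := boolP (v \in A).
    by have [->] := flip_partner fA vA nv.
  have vB : v \in B by move: vu; rewrite mem_cat mem_rev (negPf vA).
  have [pB _ _] := flip_partner fB vB nv.
  have := uu; rewrite cat_uniq => /and3P[_ /hasPn/(_ (pi v))]; rewrite mem_rev pB.
  by move=> /(_ isT)/negPf.
(* Reversing the path B exchanges the first and second letters of its strands. *)
pose tau v := side A v * sigma v.
have fu : flip tau pi (A ++ rev B) (A' ++ rev B').
  apply: patch_cat.
    apply: patch_impl fA => [v vA|x y s xA yA [ey ex -> sx sy]].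
      by rewrite /tau /side vA mul1r.
    split; first by split; rewrite // /tau /side ?xA ?yA ?sx ?sy.
    by move=> v; rewrite !inE => /orP[]/eqP->; rewrite /tau /side ?xA ?yA ?sx ?sy.
  have nA v : v \in rev B -> side A v = -1.
    move=> vB; rewrite /side; case: ifP => // vA.
    by have := uu; rewrite cat_uniq => /and3P[_ /hasPn/(_ v vB)/= ]; rewrite vA.
  apply: patch_impl (flip_rev fB) => [v vB|x y s xB yB [ey ex -> sx sy]].
    by rewrite /tau nA // mulN1r.
  split; first by split; rewrite // /tau nA // mulN1r.
  by move=> v; rewrite !inE => /orP[]/eqP->; rewrite /tau nA // mulN1r ?sx ?sy.
rewrite (@flat_writhe_flip _ _ _ _ _ _ cu fu).
  apply: eq_flat_writhe; first exact: closed_word_perm (flip_perm fu) cu.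
  by move=> v _; apply: eq_swt; rewrite (perm_mem pA).
move=> v vu; have vw := inw v vu; have [s0v _|ns] := eqVneq (sigma v) 0.
  by rewrite /tau s0v third_core // !(mulr0, mul0r).
rewrite swtE /tau => nv; have wv : wt v != 0.
  by apply: contraNneq nv => ->; rewrite mulr0.
have [_ _ hex bal] := (proj2 tm) v vw ns.
have nms : sigma (mate v) != 0.
  have [_ h _ _] := (proj2 tm) v vw ns; by rewrite h !inE eqxx orbT.
have mvu := mu v vu; have [pu _ sp] := flip_partner fw vw ns.
have [pmu _ spm] := flip_partner fw (inw _ mvu) nms.
have e1 : side A (pi v) = side A v by rewrite /side sA.
have e2 : side A (pi (mate v)) = side A (mate v) by rewrite /side sA.
(* The mates of the partners of v and mate v form the third strand, which lies
   on one side. *)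
have e3 : side A (mate (pi (mate v))) = side A (mate (pi v)).
  rewrite -hex /side sA //.
    have := flip_partner fu vu; rewrite /tau => -[].
      by rewrite mulf_neq0 // /side; case: ifP.
    by move=> h _ _; apply: mu.
  have [_ h _ _] := (proj2 tm) v vw ns; by rewrite h !inE eqxx !orbT.
have sq x : side A x * side A x = 1 by rewrite /side; case: ifP.
rewrite !swtE e1 e2 e3.
transitivity (side A v * side A v * side A (mate (pi v)) * (sigma v * wt (pi v))).
  by ring.
rewrite bal // sq -(sq (mate v)); ring.
Qed.

End ThirdMove.

(** The inverse of a third move is a third move. *)
Lemma third_move_sym sigma pi w w' : wf_word w -> third_move sigma pi w w' ->
  third_move (fun v => - sigma v) pi w' w.
Proof.
move=> wfw [fw h]; split; first exact: flip_sym fw.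
move=> a; rewrite -(perm_mem (flip_perm fw)) oppr_eq0 => aw /(h a aw)[h1 h2 h3 h4].
split => // [v|wa]; first by rewrite oppr_eq0.
by rewrite !mulNr h4.
Qed.

(** A crossing of the triangle, read from the visit a that comes first in its
    strand; the other case follows by exchanging w and w'. *)
Lemma smooth_third_first n sigma pi w w' a : wf_word w -> third_move sigma pi w w' ->
  a \in w -> sigma a = 1 -> wt a != 0 ->
  dwrithe n (smooth w a) = dwrithe n (smooth w' a).
Proof.
move=> wfw tm aw sa wa; have [fw htm] := tm; have wfw' := third_wf wfw tm.
have na : sigma a != 0 by rewrite sa.
have [uh hex pmp bal] := htm a aw na.
have cw := closed_wf wfw; have [uw mw] := cw.
have [P [x [y [R [P' [s [R' [[ew ew' [ey ex es sx sy] eax] [fP fR]]]]]]]]] :=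
  patch_split_pair fw aw na.
have {eax} ax : a = x by case: eax => // e; rewrite e sy in sa.
move: ew ew'; rewrite es -ax; rewrite -ax in ey ex; rewrite ey => ew ew'.
move=> {x y s es sx sy ax ey ex}.
set b := pi a in ew ew' *.
have fV : flip sigma pi (R ++ P) (R' ++ P') by apply: patch_cat.
have nb : sigma b != 0 by rewrite hex !inE eqxx !orbT.
have nma : sigma (mate a) != 0 by rewrite hex !inE eqxx !orbT.
have mab : mate a != b by move: uh; rewrite /= !inE !negb_or -/b => /and3P[_ /and3P[]].
have maV : mate a \in R ++ P.
  have := mw a aw; rewrite ew !mem_cat !inE (negPf (mate_neq a)) (negPf mab) /= orbC.
  by rewrite -mem_cat.
have [X [x [y [Y [X' [s [Y' [[eV eV' [ey ex es sx sy] eax] [fX fY]]]]]]]]] :=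
  patch_split_pair fV maV nma.
rewrite {s}es in eV'.
have ow : rot (size P) w = a :: b :: X ++ x :: y :: Y.
  by rewrite ew rot_size_cat /= eV.
have ow' : exists k, rot k w' = a :: X' ++ [:: y; x] ++ Y' ++ [:: b].
  exists (size (rcons P' b)).
  have -> : w' = rcons P' b ++ a :: R' by rewrite ew' cat_rcons.
  by rewrite rot_size_cat /= -cats1 catA eV' -!catA.
have [k' {}ow'] := ow'.
have pab : perm_eq w (a :: b :: X ++ x :: y :: Y) by rewrite -ow perm_sym perm_rot.
have uall : uniq (a :: b :: X ++ x :: y :: Y) by rewrite -(perm_uniq pab).
pose d := pi (mate a).
have bal' : wt b = sigma (mate a) * wt d by rewrite -bal // sa mul1r.
have pmb : pi (mate b) = mate d by [].
have nmb : sigma (mate b) != 0 by rewrite hex !inE eqxx !orbT.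
have nd : sigma d != 0 by rewrite hex !inE eqxx !orbT.
have nmd : sigma (mate d) != 0 by rewrite hex !inE eqxx !orbT.
have bw : b \in w by have [] := flip_partner fw aw na.
have pmd : pi (mate d) = mate b.
  have [_ e _] := flip_partner fw (mw _ bw) nmb; by rewrite -pmb e.
have hu : [/\ mate b != b, mate b != d, mate d != b & mate d != d].
  rewrite !mate_neq; split => //; move: uh; rewrite /hexagon /= -/b -/d !inE !negb_or.
    by case/and5P=> _ _ _ /andP[]; rewrite eq_sym.
  by case/and4P=> _ _ /and3P[_ _]; rewrite eq_sym.
case: hu => mbb mbd mdb mdd.
have uxy : uniq [:: a; b; x; y] /\ {in X ++ rev Y, forall v, v \notin [:: a; b; x; y]}.
  have p : perm_eq (a :: b :: X ++ x :: y :: Y) ([:: a; b; x; y] ++ (X ++ rev Y)).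
    by clear; apply/permP => q; rewrite /= !count_cat /= count_rev; lia.
  have := uall; rewrite (perm_uniq p) cat_uniq => /and3P[-> /hasPn hn _]; split => //.
have [u4 n4] := uxy.
have xyd : [:: a; b; x; y] =i [:: a; b; mate a; d].
  by case: eax => e v; rewrite /d e -?ey -?ex // !inE; do !case: eqP.
have nc : {in X ++ rev Y, forall v, sigma v != 0 -> v = mate b \/ v = mate d}.
  move=> v vXY; rewrite hex; have := n4 v vXY; rewrite xyd !inE -/b -/d !negb_or.
  by case/and4P=> /negPf-> /negPf-> /negPf-> /negPf-> /= /orP[]/eqP; [left|right].
have tX : (mate d \in X) = (mate b \in X).
  apply/idP/idP => h; first by have [] := flip_partner fX h nmd; rewrite pmd.
  by have [] := flip_partner fX h nmb; rewrite pmb.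
have pX := flip_perm fX.
have bX : b \notin X.
  apply/negP => h; have := n4 b; rewrite mem_cat h => /(_ isT).
  by rewrite !inE eqxx /= orbT.
have dX : d \notin X.
  apply/negP => h; have := n4 d; rewrite mem_cat h => /(_ isT).
  by rewrite xyd !inE eqxx !orbT.
have upl : uniq [:: b; d; mate b; mate d].
  by case/andP: uh => _ /andP[_].
(* d is the partner of mate a: a and b lie on one strand, mate a and d on the
   other one, and the third strand consists of mate b and mate d. *)
have cap A A' u1 u2 : closed_word u1 ->
    (u1 = b :: X ++ rev Y ++ [:: d] /\ u2 = X' ++ [:: d, b & rev Y']
     \/ u1 = b :: X ++ d :: rev Y /\ u2 = X' ++ b :: rev Y' ++ [:: d]) ->
    (forall v, v != b -> v != d -> (v \in A) = (v \in X) /\ (v \in A') = (v \in X')) ->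
    [/\ b \in A, b \notin A', side A d * wt d = - wt b & side A' d * wt d = wt b] ->
  flat_writhe n%:Z (swt A) u1 = flat_writhe n%:Z (swt A') u2.
  move=> cu sh mA [bA bA' sd sd'].
  have side_t v : v != b -> v != d -> side A v = side X v /\ side A' v = side X v.
    by move=> vb vd; have [e e'] := mA v vb vd; rewrite /side e e' (perm_mem pX).
  have [e1 e1'] := side_t _ mbb mbd; have [e2 e2'] := side_t _ mdb mdd.
  have e3 : side X (mate d) = side X (mate b) by rewrite /side tX.
  have sb : side A b = 1 by rewrite /side bA.
  have sb' : side A' b = -1 by rewrite /side (negPf bA').
  apply: (flat_writhe_cap _ cu sh fX (flip_rev fY)) => //.
  - by move=> v; apply: (@swt_odd A [:: v]); rewrite inE.
  - by move=> v; apply: (@swt_odd A' [:: v]); rewrite inE.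
  - move=> v vXY s0; have vw : v \in w.
      rewrite (perm_mem pab); move: vXY; rewrite !inE !mem_cat mem_rev !inE.
      by case/orP=> ->; rewrite !orbT.
    have s0' := third_core wfw tm vw s0; split => //.
    have nbd z : sigma z = 0 -> z != b /\ z != d.
      by move=> z0; split; apply: contra_eq_neq z0 => ->.
    have [h1 h2] := nbd _ s0; have [h3 h4] := nbd _ s0'.
    have [g1 g2] := side_t v h1 h2; have [g3 g4] := side_t _ h3 h4.
    by rewrite !swtE g1 g2 g3 g4.
  - rewrite !swtE e1 e1' e2 e2' e3 sb sb'; split.
    + by rewrite mulrAC sd; ring.
    + by ring.
    + by rewrite mulrAC sd'; ring.
  - by move=> v; rewrite !inE => /or4P[]/eqP->.
(* Either mate a comes first on its strand, as a does, or it comes last. *)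
case: eax => eax.
  have yd : y = d by rewrite ey -eax.
  have owE : rot (size P) w = a :: (b :: X) ++ mate a :: (d :: Y) by rewrite ow -eax yd.
  have owE' : rot k' w' = a :: (X' ++ [:: d]) ++ mate a :: (Y' ++ [:: b]).
    by rewrite ow' -eax yd -!catA.
  rewrite (dwrithe_smooth wfw owE) (dwrithe_smooth wfw' owE').
  apply: cap; first exact: smooth_closed wfw owE.
  - by left; rewrite !rev_cons rev_cat -cats1 -!catA.
  - by move=> v /negPf vb /negPf vd; rewrite !(inE, mem_cat) vb vd orbF.
  - have bd : b != d by move: upl; rewrite /= !inE negb_or => /andP[/andP[]].
    rewrite /side !(inE, mem_cat) !eqxx -!(perm_mem pX) (negPf bX) (negPf dX).
    have db : (d == b) = false by rewrite eq_sym (negPf bd).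
    by rewrite (negPf bd) db bal' eax sx /= ?orbT; split => //; ring.
have xd : x = d by rewrite ex -eax.
have owE : rot (size P) w = a :: (b :: X ++ [:: d]) ++ mate a :: Y.
  by rewrite ow -eax xd /= -catA.
have owE' : rot k' w' = a :: X' ++ mate a :: (d :: Y' ++ [:: b]) by rewrite ow' -eax xd.
rewrite (dwrithe_smooth wfw owE) (dwrithe_smooth wfw' owE').
apply: cap; first exact: smooth_closed wfw owE.
- by right; rewrite !rev_cons rev_cat /= -cats1 -!catA.
- by move=> v /negPf vb /negPf vd; rewrite !(inE, mem_cat) vb vd orbF.
- rewrite /side !(inE, mem_cat) !eqxx !orbT -!(perm_mem pX) (negPf bX) (negPf dX).
  by rewrite bal' eax sy /= ?orbT; split => //; ring.
Qed.

Lemma Fpoly_third n sigma pi w w' : wf_word w -> third_move sigma pi w w' ->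
  Fpoly n w = Fpoly n w'.
Proof.
move=> wfw tm; have [fw _] := tm; have wfw' := third_wf wfw tm.
apply: (@eq_Fpoly_extra _ _ _ [::]); first exact: flip_perm fw.
- exact: third_dwrithe wfw tm n.
- move=> c; rewrite -(perm_mem (third_crossings tm)) => cc.
  split; first exact: third_Ind tm _ cc.
  move: cc; rewrite mem_crossings => /andP[/eqP lc cw].
  have wc : wt c != 0 by rewrite wt_sgn // /sgn; case: (rising c).
  case: (flip_sign fw cw) => sc.
  + exact: smooth_third_core tm _ _ cw sc.
  + exact: smooth_third_first tm cw sc wc.
  apply/esym; apply: smooth_third_first (third_move_sym wfw tm) _ _ wc => //.
    by rewrite -(perm_mem (flip_perm fw)).
  by rewrite sc opprK.
- by rewrite big_nil.
Qed.

(** * First and second moves *)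

(** What the invariance uses of a first or second move: the letters pl are
    deleted in consecutive pairs of opposite weights, and the map pi
    exchanging the letters of each pair commutes with mate. *)
Definition removal (pl : word) (pi : visit -> visit) (w w' : word) : Prop :=
  [/\ del pl pi w w', perm_eq w (pl ++ w'), perm_eq (map pi pl) pl
    & {in pl, forall v, [/\ wt (pi v) = - wt v, pi (mate v) = mate (pi v)
                          & mate v \in pl]}].

Lemma closed_word_drop pl u : closed_word (pl ++ u) ->
  {in pl, forall v, mate v \in pl} -> closed_word u.
Proof.
move=> [uu mu] mp; move: (uu); rewrite cat_uniq => /and3P[_ /hasPn hn uu2].
split => // v vu; have := mu v; rewrite !mem_cat vu orbT => /(_ isT)/orP[|//].
by move=> /mp; rewrite mateK => vp; have := hn v vu; rewrite vp.
Qed.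

Section Removal.

Variables (pl : word) (pi : visit -> visit) (w w' : word).
Hypotheses (wfw : wf_word w) (rm : removal pl pi w w').

Let dw : del pl pi w w'. Proof. by case: rm. Qed.
Let pw : perm_eq w (pl ++ w'). Proof. by case: rm. Qed.
Let ppl : perm_eq (map pi pl) pl. Proof. by case: rm. Qed.
Let wpi v : v \in pl -> wt (pi v) = - wt v. Proof. by case: rm => _ _ _ h /h[]. Qed.
Let pimate v : v \in pl -> pi (mate v) = mate (pi v).
Proof. by case: rm => _ _ _ h /h[]. Qed.
Let plmate v : v \in pl -> mate v \in pl. Proof. by case: rm => _ _ _ h /h[]. Qed.
Let cw : closed_word w. Proof. exact: closed_wf. Qed.

Let w'w v : v \in w' -> v \in w.
Proof. by rewrite (perm_mem pw) mem_cat orbC => ->. Qed.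

Let plw v : v \in pl -> v \in w.
Proof. by rewrite (perm_mem pw) mem_cat => ->. Qed.

Let w'pl v : v \in w' -> v \notin pl.
Proof.
have := wf_uniq wfw; rewrite (perm_uniq pw) cat_uniq => /and3P[_ /hasPn hn _].
exact: hn.
Qed.

Lemma removal_wf : wf_word w'.
Proof.
apply: wf_intro.
  apply: (@closed_word_drop pl) => //; exact: closed_word_perm cw.
by move=> u v /w'w uw /w'w vw; exact: wf_same_name wfw uw vw.
Qed.

Let cw' : closed_word w'. Proof. exact: closed_wf removal_wf. Qed.

Lemma removal_dwrithe n : dwrithe n w = dwrithe n w'.
Proof.
rewrite !dwritheE ?removal_wf //; apply: (flat_writhe_del _ cw cw' pw dw ppl).
  by move=> v vp; rewrite wpi ?pimate.
by move=> v vp; rewrite plmate ?wt_mate.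
Qed.

Let chains := chain_del dw (fun v _ => @wpi v)
  (chain_pre wt (proj1 cw)) (chain_pre wt (proj1 cw')).

Lemma removal_Ind c : c \in crossings w' -> Ind w c = Ind w' c.
Proof.
move=> cc; move: (cc); rewrite mem_crossings => /andP[lc cin].
rewrite (Ind_gap removal_wf) // Ind_gap //; last by rewrite mem_crossings lc w'w.
have mc := proj2 cw' c cin; have [h _ _] := chains.
by rewrite /gap !h ?w'w ?w'pl //; lia.
Qed.

Lemma removal_gap v : v \in pl -> gap wt (pre wt w) (pi v) = gap wt (pre wt w) v.
Proof.
move=> vp; have [_ h _] := chains; have mp := plmate vp.
by rewrite /gap -pimate // !h ?plw // wpi // wt_mate; lia.
Qed.

Lemma removal_smooth n c : c \in w' ->
  dwrithe n (smooth w c) = dwrithe n (smooth w' c).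
Proof.
move=> cin; have mc := proj2 cw' c cin.
have [||k [k' [A [B [A' [B' [ew ew' dA dB]]]]]]] := patch_rot_split cw dw (w'w cin).
- exact: w'pl.
- exact: w'pl.
rewrite (dwrithe_smooth wfw ew) (dwrithe_smooth removal_wf ew').
have cu := smooth_closed wfw ew; have [uu mu] := cu.
have cu' := smooth_closed removal_wf ew'.
have puu : perm_eq (A ++ rev B) (pl ++ (A' ++ rev B')).
  apply/permP => q; have := permP pw q.
  have cr j (u : word) : count q (rot j u) = count q u.
    by have /permP : perm_eq (rot j u) u by rewrite perm_rot.
  rewrite -(cr k) ew [in RHS]count_cat -(cr k' w') ew' /=.
  by rewrite !count_cat /= !count_rev; clear; lia.
have dd : del pl pi (A ++ rev B) (A' ++ rev B') by apply: patch_cat (del_rev dB).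
have plu v : v \in pl -> v \in A ++ rev B by rewrite (perm_mem puu) mem_cat => ->.
have sA v : v \in pl -> side A (pi v) = side A v.
  move=> vp; rewrite /side; have [vA|vA] := boolP (v \in A).
    by rewrite (del_partner dA).
  have vB : v \in rev B by move: (plu v vp); rewrite mem_cat (negPf vA).
  have pB := del_partner (del_rev dB) vB vp.
  have := uu; rewrite cat_uniq => /and3P[_ /hasPn/(_ (pi v) pB)].
  by move=> /negPf ->.
rewrite (flat_writhe_del _ cu cu' puu dd ppl).
- apply: eq_flat_writhe => // v vu; have vp : v \notin pl.
    have := uu; rewrite (perm_uniq puu) cat_uniq => /and3P[_ /hasPn h _].
    exact: h.
  have mvp : mate v \notin pl.
    by apply: contra vp => /plmate; rewrite mateK.
  by apply: eq_swt; apply/esym; apply: patch_mem dA _.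
- move=> v vp; split; last exact: pimate.
  by rewrite !swtE -pimate // !sA ?plmate // wpi // mulrN.
- move=> v vp; split; first exact: plmate.
  by apply: (@swt_odd A [:: v]); rewrite inE.
Qed.

(** It remains to evaluate the terms of the crossings that are removed. *)
Lemma Fpoly_removal n : \sum_(c <- crossings pl) Fterm n w c = 0 ->
  Fpoly n w = Fpoly n w'.
Proof.
apply: eq_Fpoly_extra pw (removal_dwrithe n) _ => c cc.
split; first exact: removal_Ind.
by apply: removal_smooth; move: cc; rewrite mem_crossings => /andP[].
Qed.

End Removal.

Lemma Fsummand_trivial s a d : a = d \/ a = - d -> Fsummand s 0 a d = 0.
Proof. by rewrite /Fsummand; case=> ->; rewrite eqxx ?orbT subrr. Qed.

Lemma termN s i a : term (- s) i a = - term s i a.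
Proof. exact: monalgUN. Qed.

Lemma Fsummand_opp s i a d : Fsummand (- s) i a d = - Fsummand s i a d.
Proof. by rewrite /Fsummand !termN opprD. Qed.

Lemma Fpoly_first n w1 w2 v :
  wf_word (w1 ++ [:: v; mate v] ++ w2) ->
  Fpoly n (w1 ++ w2) = Fpoly n (w1 ++ [:: v; mate v] ++ w2).
Proof.
set w := w1 ++ _ ++ w2 => wfw; set w' := w1 ++ w2.
pose pl := [:: v; mate v].
have pw : perm_eq w (pl ++ w') by rewrite /w perm_catCA.
have nc : {in w', forall u, u \notin pl}.
  have := wf_uniq wfw; rewrite (perm_uniq pw) cat_uniq => /and3P[_ /hasPn hn _].
  exact: hn.
have rm : removal pl mate w w'.
  split => //.
  - exact: del_chord.
  - by rewrite /= mateK; exact: perm_swap2.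
  by move=> u; rewrite !inE => /orP[]/eqP->; rewrite ?mateK ?wt_mate ?opprK ?eqxx ?orbT.
apply/esym/(Fpoly_removal wfw rm).
have vp : v \in pl by rewrite inE eqxx.
have wfw' := removal_wf wfw rm; have cw' := closed_wf wfw'.
have inw u : u \in pl -> u \in w by rewrite (perm_mem pw) mem_cat => ->.
have mvp : mate v \in pl by rewrite !inE eqxx orbT.
have dw : dwrithe n w = flat_writhe n%:Z wt (w2 ++ w1).
  rewrite (removal_dwrithe wfw rm) dwritheE // -(rot_size_cat w1 w2).
  by rewrite flat_writhe_rot //; exact: wt_odd.
have cw21 : closed_word (w2 ++ w1) by apply: closed_word_perm cw'; rewrite perm_catC.
have g0 : gap wt (pre wt w) v = 0.
  have := removal_gap wfw rm vp; rewrite (gap_mate _ (@wt_odd w)) ?inw //; lia.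
have swt_nil u : swt [::] u = wt u by [].
have swt_all : {in w2 ++ w1, swt (w2 ++ w1) =1 wt}.
  by move=> u uw; rewrite /swt uw (proj2 cw21).
have tv : lev v = Over -> Fterm n w v = 0.
  move=> lv; rewrite /Fterm Ind_gap ?mem_crossings ?lv ?inw // g0.
  apply: Fsummand_trivial; right.
  have ew : rot (size w1) w = v :: [::] ++ mate v :: (w2 ++ w1).
    by rewrite /w rot_size_cat.
  rewrite (dwrithe_smooth wfw ew) dw cat0s.
  by rewrite flat_writhe_rev //; exact: swt_odd.
have tmv : lev (mate v) = Over -> Fterm n w (mate v) = 0.
  move=> lv; rewrite /Fterm Ind_gap ?mem_crossings ?lv ?inw //.
  rewrite (gap_mate _ (@wt_odd w)) ?inw // g0 oppr0.
  apply: Fsummand_trivial; left.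
  have ew : rot (size (rcons w1 v)) w = mate v :: (w2 ++ w1) ++ mate (mate v) :: [::].
    have -> : w = rcons w1 v ++ mate v :: w2 by rewrite cat_rcons.
    by rewrite rot_size_cat mateK /= -cats1 catA.
  rewrite (dwrithe_smooth wfw ew) dw cats0.
  exact: eq_flat_writhe.
rewrite /crossings /=; case: eqP => [lv|_]; case: eqP => [lmv|_].
- by rewrite big_cons big_seq1 tv // tmv // addr0.
- by rewrite big_seq1 tv.
- by rewrite big_seq1 tmv.
- by rewrite big_nil.
Qed.

(** Removing two consecutive visits to the same double point. *)
Lemma flat_writhe_kink n e X v Z : closed_word (X ++ [:: v; mate v] ++ Z) ->
  (forall u, e (mate u) = - e u) ->
  closed_word (X ++ Z) /\
  flat_writhe n e (X ++ [:: v; mate v] ++ Z) = flat_writhe n e (X ++ Z).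
Proof.
move=> cu oe; have [uu _] := cu.
have pu : perm_eq (X ++ [:: v; mate v] ++ Z) ([:: v; mate v] ++ (X ++ Z)).
  by rewrite perm_catCA.
have mp : {in [:: v; mate v], forall u, mate u \in [:: v; mate v]}.
  by move=> u; rewrite !inE => /orP[]/eqP->; rewrite ?mateK eqxx ?orbT.
have cu' : closed_word (X ++ Z).
  by apply: closed_word_drop mp; apply: closed_word_perm cu.
have nc : {in X ++ Z, forall u, u \notin [:: v; mate v]}.
  by move: uu; rewrite (perm_uniq pu) cat_uniq => /and3P[_ /hasPn hn _].
split => //; apply: (@flat_writhe_del n e [:: v; mate v] mate) => //.
- exact: del_chord.
- by rewrite /= mateK; exact: perm_swap2.
- by move=> u up; split; first exact: mp.
Qed.

(** The smoothings at the two crossings of a second move have the same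
    dwrithes. *)
Lemma smooth_second n w k p q s Y Z : wf_word w ->
  rot k w = [:: p; q] ++ Y ++ s ++ Z -> wt q = - wt p ->
  s = [:: mate p; mate q] \/ s = [:: mate q; mate p] ->
  dwrithe n (smooth w p) = dwrithe n (smooth w q).
Proof.
move=> wfw ew wpq es; have [uw _] := closed_wf wfw.
have [k' ew'] : exists k', rot k' w = q :: Y ++ s ++ Z ++ [:: p].
  have [k' e] := rot_rot_ex k 1 w; exists k'.
  by rewrite -e ew rot1_cons /= -cats1 -!catA.
have pu : perm_eq w ([:: p; q] ++ s ++ (Y ++ Z)).
  by rewrite -(perm_rot k) ew perm_cat2l perm_catCA.
have {}pu : perm_eq w ([:: p; q; mate p; mate q] ++ (Y ++ rev Z)).
  apply: perm_trans pu _.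
  rewrite -[X in perm_eq _ (X ++ _)]/([:: p; q] ++ [:: mate p; mate q]).
  rewrite -[X in perm_eq _ X]catA perm_cat2l; apply: perm_cat.
    by case: es => -> //; exact: perm_swap2.
  by rewrite perm_cat2l perm_sym perm_rev.
have := uw; rewrite (perm_uniq pu) cat_uniq => /and3P[upl /hasPn nc _].
have mpl : {in [:: p; q; mate p; mate q], forall v, mate v \in [:: p; q; mate p; mate q]}.
  by move=> v; rewrite !inE => /or4P[]/eqP->; rewrite ?mateK eqxx ?orbT.
have cK : closed_word (Y ++ rev Z).
  by apply: closed_word_drop mpl; apply: closed_word_perm (closed_wf wfw).
have mnc v : v \in Y ++ rev Z -> mate v \notin [:: p; q; mate p; mate q].
  by move=> /(proj2 cK)/nc.
have oe A v : swt A (mate v) = - swt A v by apply: (@swt_odd A [:: v]); rewrite inE.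
have qY : q \notin Y.
  by apply/negP => h; have := nc q; rewrite mem_cat h !inE eqxx orbT => /(_ isT).
have pY : p \notin Y.
  by apply/negP => h; have := nc p; rewrite mem_cat h !inE eqxx => /(_ isT).
have mqY : mate q \notin Y.
  by apply/negP => h; have := nc (mate q); rewrite mem_cat h !inE eqxx !orbT => /(_ isT).
have mpY : mate p \notin Y.
  by apply/negP => h; have := nc (mate p); rewrite mem_cat h !inE eqxx !orbT => /(_ isT).
have out v : v \in Y ++ rev Z ->
    [/\ (v == p) = false, (v == q) = false, (v == mate p) = false & (v == mate q) = false].
  by move/nc; rewrite !inE !negb_or => /and4P[/negPf-> /negPf-> /negPf-> /negPf->].
(* In this case both smoothings have a loop, whose removal leaves Y ++ rev Z. *)
case: es => es.
  have ep : rot k w = p :: (q :: Y) ++ mate p :: (mate q :: Z) by rewrite ew es.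
  have eq : rot k' w = q :: (Y ++ [:: mate p]) ++ mate q :: (Z ++ [:: p]).
    by rewrite ew' es -!catA.
  have cp := smooth_closed wfw ep; have cq := smooth_closed wfw eq.
  rewrite (dwrithe_smooth wfw ep) (dwrithe_smooth wfw eq).
  rewrite -(flat_writhe_rot _ (size (q :: Y ++ rev Z)) cp (@swt_odd _ _)).
  have ru : rot (size (q :: Y ++ rev Z)) ((q :: Y) ++ rev (mate q :: Z))
      = [::] ++ [:: mate q; mate (mate q)] ++ (Y ++ rev Z).
    rewrite rev_cons -cats1 catA -[(q :: Y) ++ rev Z]/(q :: Y ++ rev Z).
    by rewrite rot_size_cat mateK.
  have cr : closed_word ([::] ++ [:: mate q; mate (mate q)] ++ (Y ++ rev Z)).
    by rewrite -ru; apply: closed_word_perm cp; rewrite perm_sym perm_rot.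
  have rq : (Y ++ [:: mate p]) ++ rev (Z ++ [:: p])
      = Y ++ [:: mate p; mate (mate p)] ++ rev Z.
    by rewrite rev_cat mateK -catA.
  rewrite rq in cq *; rewrite ru.
  have [_ ->] := flat_writhe_kink n%:Z cr (oe (q :: Y)).
  have [_ ->] := flat_writhe_kink n%:Z cq (oe (Y ++ [:: mate p])).
  apply: eq_flat_writhe => // v vK; have [h1 h2 h3 h4] := out v vK.
  have [g1 g2 g3 g4] := out _ (proj2 cK v vK).
  by apply: eq_swt; rewrite !inE !mem_cat !inE ?h2 ?h3 ?g2 ?g3 ?orbF.
(* Now mate p in the smoothing at q plays the role of q in the smoothing at p. *)
have ep : rot k w = p :: (q :: Y ++ [:: mate q]) ++ mate p :: Z.
  by rewrite ew es /= -catA.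
have eq : rot k' w = q :: Y ++ mate q :: (mate p :: Z ++ [:: p]) by rewrite ew' es.
have cp := smooth_closed wfw ep; have cq := smooth_closed wfw eq.
rewrite (dwrithe_smooth wfw ep) (dwrithe_smooth wfw eq).
set E1 := swt _; set E2 := swt Y.
have up : (q :: Y ++ [:: mate q]) ++ rev Z = q :: Y ++ mate q :: rev Z.
  by rewrite /= -catA.
have uq : Y ++ rev (mate p :: Z ++ [:: p]) = Y ++ p :: rev Z ++ [:: mate p].
  by rewrite rev_cons rev_cat /= -cats1.
rewrite up in cp *; rewrite uq in cq *.
have E1q : E1 q = wt q by rewrite /E1 /swt !(inE, mem_cat) !eqxx /= !orbT.
have E2p : E2 p = - wt q by rewrite /E2 /swt (negPf pY) (negPf mpY) wpq opprK.
have eE : {in Y ++ rev Z, E1 =1 E2}.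
  move=> v vK; have [h1 h2 h3 h4] := out v vK.
  have [g1 g2 g3 g4] := out _ (proj2 cK v vK).
  by apply: eq_swt; rewrite !(inE, mem_cat) ?h2 ?h4 ?g2 ?g4 ?orbF.
have ch1 := chain_pre E1 (proj1 cp).
have := chain_shift (wt q) (chain_pre E2 (proj1 cq)); set Q2 := fun v => _ => ch2.
have t0 : tot E1 (q :: Y ++ mate q :: rev Z) = 0 by apply: tot0 => // v _; apply: oe.
set Q1 := pre E1 _ in ch1.
have tY : tot E1 Y = tot E2 Y.
  rewrite /tot big_seq [RHS]big_seq; apply: eq_bigr => v vY.
  by apply: eE; rewrite mem_cat vY.
have tZ : tot E1 (rev Z) = tot E2 (rev Z).
  rewrite /tot big_seq [RHS]big_seq; apply: eq_bigr => v vZ.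
  by apply: eE; rewrite mem_cat vZ orbT.
move: (ch1) (ch2); rewrite /= => -[Q1q /chain_cat[cY [Q1mq cZ]]].
move=> /chain_cat[cY' [Q2p /chain_cat[cZ' [Q2mp _]]]].
move: t0; rewrite !(tot_cons, tot_cat) => t0.
have emq : E1 (mate q) = - wt q by rewrite /E1 oe -/E1 E1q.
apply: (@flat_writhe_compare n%:Z E1 E2 Q1 Q2 _ _ _ _ [:: q; mate q]
  [:: p; mate p] (Y ++ rev Z) cp cq ch1 ch2).
- by apply/permP => r; rewrite /= !count_cat /=; clear; lia.
- by apply/permP => r; rewrite /= !count_cat /= !count_cat /=; clear; lia.
- exact: (proj2 cK).
- exact: eE.
- move=> v; rewrite mem_cat => /orP[vY|vZ].
    rewrite (@chain_diff E1 E2 Q1 Q2 _ _ Y _ cY cY' v vY).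
      by rewrite E1q; ring.
    by move=> u uY; apply: eE; rewrite mem_cat uY.
  rewrite (@chain_diff E1 E2 Q1 Q2 _ _ (rev Z) _ cZ cZ' v vZ).
    by rewrite E1q emq E2p tY; ring.
  by move=> u uZ; apply: eE; rewrite mem_cat uZ orbT.
have g1 : gap E1 Q1 (mate q) = - gap E1 Q1 q by rewrite /gap mateK emq E1q; ring.
have emp : E2 (mate p) = wt q by rewrite /E2 oe -/E2 E2p opprK.
have g2 : gap E2 Q2 (mate p) = - gap E2 Q2 p by rewrite /gap mateK emp E2p; ring.
have g3 : gap E2 Q2 p = - gap E1 Q1 q.
  rewrite /gap Q2mp Q2p Q1q Q1mq E2p E1q -tY -tZ; move: t0; rewrite E1q emq.
  by clear; lia.
rewrite !big_cons !big_nil /=.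
rewrite g1 g2 g3 opprK emq emp E2p E1q.
by case: (_ == _); case: (_ == _); ring.
Qed.

(** The terms of the two crossings of a second move cancel. *)
Lemma second_cancel n w k p q s Y Z : wf_word w ->
  rot k w = [:: p; q] ++ Y ++ s ++ Z -> lev p = Over -> lev q = Over ->
  wt q = - wt p -> gap wt (pre wt w) q = gap wt (pre wt w) p ->
  s = [:: mate p; mate q] \/ s = [:: mate q; mate p] ->
  Fterm n w p + Fterm n w q = 0.
Proof.
move=> wfw ew lp lq wpq gpq es.
have pw : p \in w by rewrite -(mem_rot k) ew inE eqxx.
have qw : q \in w by rewrite -(mem_rot k) ew !inE eqxx orbT.
have ds := smooth_second n wfw ew wpq es.
have ip : Ind w q = Ind w p by rewrite !Ind_gap // mem_crossings ?lp ?lq.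
have sq : sgn q = - sgn p by rewrite -!wt_sgn.
by rewrite /Fterm ip sq ds Fsummand_opp subrr.
Qed.

Lemma Fpoly_second n w1 w2 w3 p q s :
  wf_word (w1 ++ [:: p; q] ++ w2 ++ s ++ w3) ->
  lev q = lev p -> rising q = ~~ rising p ->
  s = [:: mate p; mate q] \/ s = [:: mate q; mate p] ->
  Fpoly n (w1 ++ w2 ++ w3) = Fpoly n (w1 ++ [:: p; q] ++ w2 ++ s ++ w3).
Proof.
set w := w1 ++ [:: p; q] ++ _ => wfw lpq rpq es.
pose pl := [:: p; q; mate p; mate q]; set w' := w1 ++ w2 ++ w3.
have wpq : wt q = - wt p.
  by rewrite /wt /classical lpq rpq; case: (lev p) => //; case: (rising p) => /=; ring.
have pw : perm_eq w (pl ++ w').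
  have ps : perm_eq s [:: mate p; mate q] by case: es => -> //; exact: perm_swap2.
  apply/permP => r; have /permP/(_ r) := ps; rewrite /w /w' /pl /= !count_cat /= !count_cat.
  by clear; lia.
have := wf_uniq wfw; rewrite (perm_uniq pw) cat_uniq => /and3P[upl /hasPn nc _].
have [dpq dpm dpn dqm] : [/\ p != q, p != mate q, q != mate p & mate p != mate q].
  move: upl; rewrite /= !inE !negb_or -!andbA.
  by case/and5P=> -> _ -> -> /and3P[_ -> _].
pose pi v := if v == p then q else if v == q then p
  else if v == mate p then mate q else if v == mate q then mate p else v.
have pp : pi p = q by rewrite /pi eqxx.
have pq : pi q = p by rewrite /pi eqxx eq_sym (negPf dpq).
have pmp : pi (mate p) = mate q.
  by rewrite /pi (negPf (mate_neq p)) eq_sym (negPf dpn) eqxx.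
have pmq : pi (mate q) = mate p.
  by rewrite /pi eq_sym (negPf dpm) (negPf (mate_neq q)) eq_sym (negPf dqm) eqxx.
have rm : removal pl pi w w'.
  split => //.
  - have id1 u : {subset u <= w'} -> del pl pi u u.
      by move=> su; apply: patch_id => v /su; exact: nc.
    apply: patch_cat; first by apply: id1 => v vw; rewrite !mem_cat vw.
    apply: (@patch_pair _ _ p q [::]).
    + by split; rewrite ?pp ?pq.
    + by rewrite negbK !inE eqxx.
    + by rewrite negbK !inE eqxx orbT.
    + by [].
    apply: patch_cat; first by apply: id1 => v vw; rewrite !mem_cat vw orbT.
    have id3 : del pl pi w3 w3 by apply: id1 => v vw; rewrite !mem_cat vw !orbT.
    case: es => ->; apply: (@patch_pair _ _ _ _ [::]) => //;
      rewrite ?negbK ?inE ?eqxx ?orbT //; by split; rewrite ?pmp ?pmq.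
  - rewrite /= pp pq pmp pmq.
    by rewrite -[X in perm_eq X]/([:: q; p] ++ [:: mate q; mate p])
      -[X in perm_eq _ X]/([:: p; q] ++ [:: mate p; mate q]) perm_cat // perm_swap2.
  move=> v; rewrite !inE => /or4P[]/eqP->;
    by rewrite /pl !(mateK, pp, pq, pmp, pmq, wt_mate, wpq, opprK, inE, eqxx, orbT).
apply/esym/(Fpoly_removal wfw rm).
have g v : v \in pl -> gap wt (pre wt w) (pi v) = gap wt (pre wt w) v.
  exact: removal_gap wfw rm v.
have gq : gap wt (pre wt w) q = gap wt (pre wt w) p by rewrite -pp g // inE eqxx.
have gmq : gap wt (pre wt w) (mate q) = gap wt (pre wt w) (mate p).
  by rewrite -pmp g // !inE eqxx !orbT.
have wmpq : wt (mate q) = - wt (mate p) by rewrite !wt_mate wpq.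
have [lp|[lp|lp]] : lev p = Over \/ lev p = Under \/ lev p = Virtual.
- by case: (lev p); auto.
- rewrite /crossings /= lpq lp /=  big_cons big_seq1.
  apply: (@second_cancel n w (size w1) p q s w2 (w3 ++ w1)) => //.
  + by rewrite /w rot_size_cat -!catA.
  + by rewrite lpq lp.
- rewrite /crossings /= lpq lp /= big_cons big_seq1.
  (* The crossings are named by the letters of s, from which the word is read. *)
  have eP : w = (w1 ++ [:: p; q] ++ w2) ++ s ++ w3 by rewrite -!catA.
  case: es => es.
    apply: (@second_cancel n w (size (w1 ++ [:: p; q] ++ w2)) (mate p) (mate q)
      [:: p; q] (w3 ++ w1) w2) => //=; rewrite ?lpq ?lp //; last by rewrite !mateK; left.
    by rewrite eP rot_size_cat es -!catA.
  rewrite addrC.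
  apply: (@second_cancel n w (size (w1 ++ [:: p; q] ++ w2)) (mate q) (mate p)
      [:: p; q] (w3 ++ w1) w2) => //=; rewrite ?lpq ?lp //.
  + by rewrite eP rot_size_cat es -!catA.
  + by rewrite wmpq opprK.
  + by rewrite !mateK; right.
- by rewrite /crossings /= lpq lp /= big_nil.
Qed.

(** * The triangles of the third moves *)

Definition strand_letters (ss : seq strand) : word := flatten (map strand_word ss).

(** 1 on the first visits of the strands, -1 on the second ones. *)
Definition strand_sign (ss : seq strand) (v : visit) : int :=
  if v \in map fst ss then 1 else if v \in map snd ss then -1 else 0.

(** The other visit of the same strand. *)
Definition partner (ss : seq strand) (v : visit) : visit :=
  foldr (fun s r => if v == s.1 then s.2 else if v == s.2 then s.1 else r) v ss.

Lemma mem_strand_letters ss v :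
  (v \in strand_letters ss) = (v \in map fst ss) || (v \in map snd ss).
Proof.
elim: ss => //= s ss IH; rewrite !inE IH.
by case: (v == s.1); case: (v == s.2); rewrite ?orbT.
Qed.

Lemma strand_sign_neq0 ss v : (strand_sign ss v != 0) = (v \in strand_letters ss).
Proof.
rewrite mem_strand_letters /strand_sign.
by case: (v \in _); case: (v \in _).
Qed.

Lemma strandP ss s : uniq (strand_letters ss) -> s \in ss ->
  [/\ partner ss s.1 = s.2, partner ss s.2 = s.1,
      strand_sign ss s.1 = 1 & strand_sign ss s.2 = -1].
Proof.
move=> us sss; have s1 : s.1 \in map fst ss by rewrite map_f.
have s2 : s.2 \in map snd ss by rewrite map_f.
have s12 : s.2 \notin map fst ss /\ partner ss s.1 = s.2 /\ partner ss s.2 = s.1.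
  elim: ss us sss {s1 s2} => //= t ss IH.
  rewrite -/(strand_letters ss) !inE !negb_or => /and3P[/andP[t12 t1] t2 us].
  case/predU1P => [-> | sss].
    rewrite !eqxx eq_sym (negPf t12) /=; split => //.
    by move: t2; rewrite mem_strand_letters negb_or => /andP[].
  have [h1 [h2 h3]] := IH us sss.
  have m1 : s.1 \in strand_letters ss by rewrite mem_strand_letters map_f.
  have m2 : s.2 \in strand_letters ss by rewrite mem_strand_letters orbC map_f.
  have neq x y : x \notin strand_letters ss -> y \in strand_letters ss -> (y == x) = false.
    by move=> nx yy; apply: contraNF nx => /eqP <-.
  by rewrite !neq.
by rewrite /strand_sign s1 s2 (negPf s12.1); case: s12 => _ [].
Qed.

(** Around the triangle, strand i starts at xi and ends at yi when it is followed
    along the face, fi tells whether this agrees with its orientation, and yi and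
    x(i+1) are the two visits to the same crossing. The face turns left at each
    corner, which gives the value of rising at yi, hence the balance. The
    condition on classical crossings holds in RIII, VRIII and SV: two of the
    crossings have the same type whenever the third one is classical. *)
Lemma triangle_corner (sigma : visit -> int) pi x1 y1 x2 y2 x3 y3 (f1 f2 f3 : bool) :
  [/\ pi x1 = y1, pi x2 = y2 & pi x3 = y3] ->
  [/\ pi y1 = x1, pi y2 = x2 & pi y3 = x3] ->
  [/\ sigma x1 = (if f1 then 1 else -1), sigma x2 = (if f2 then 1 else -1)
    & sigma x3 = (if f3 then 1 else -1)] ->
  [/\ sigma y1 = - sigma x1, sigma y2 = - sigma x2 & sigma y3 = - sigma x3] ->
  [/\ mate y1 = x2, mate y2 = x3 & mate y3 = x1] ->
  [/\ rising y1 = (f1 == f2), rising y2 = (f2 == f3) & rising y3 = (f3 == f1)] ->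
  [/\ classical y1 -> classical y2 = classical y3,
      classical y2 -> classical y3 = classical y1
    & classical y3 -> classical y1 = classical y2] ->
  uniq [:: x1; y1; x2; y2; x3; y3] ->
  (forall v, (sigma v != 0) = (v \in [:: x1; y1; x2; y2; x3; y3])) ->
  forall a, a \in [:: x1; y1] ->
    [/\ uniq (hexagon pi a), forall v, (sigma v != 0) = (v \in hexagon pi a),
        pi (mate (pi a)) = mate (pi (mate a))
      & wt a != 0 -> sigma a * wt (pi a) = sigma (mate a) * wt (pi (mate a))].
Proof.
move=> [p1 p2 p3] [q1 q2 q3] [s1 s2 s3] [t1 t2 t3] [m1 m2 m3] [r1 r2 r3] [c1 c2 c3] u sE.
have n1 : mate x1 = y3 by rewrite -m3 mateK.
have n2 : mate x2 = y1 by rewrite -m1 mateK.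
have n3 : mate x3 = y2 by rewrite -m2 mateK.
have w1 : wt y1 = if classical y1 then (if f1 == f2 then 1 else -1) else 0 by rewrite /wt r1.
have w2 : wt y2 = if classical y2 then (if f2 == f3 then 1 else -1) else 0 by rewrite /wt r2.
have w3 : wt y3 = if classical y3 then (if f3 == f1 then 1 else -1) else 0 by rewrite /wt r3.
have v1 : wt x1 = - wt y3 by rewrite -m3 wt_mate.
have v2 : wt x2 = - wt y1 by rewrite -m1 wt_mate.
have v3 : wt x3 = - wt y2 by rewrite -m2 wt_mate.
move=> a; rewrite !inE => /orP[]/eqP->; rewrite /hexagon.
- rewrite p1 n1 q3 m1 n3 p2.
  have pe : perm_eq [:: x1; y1; x2; y2; x3; y3] [:: x1; y3; y1; x3; x2; y2].
    by clear; apply/permP => q /=; lia.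
  split => //; first by rewrite -(perm_uniq pe).
    by move=> v; rewrite sE (perm_mem pe).
  rewrite v1 oppr_eq0 w3 w1 t3 s1 s3 v3 w2; case: (classical y3) c3 => // /(_ isT) -> _.
  by case: (classical y2); case: (f1); case: (f2); case: (f3).
- rewrite q1 m1 p2 n1 m2 q3.
  have pe : perm_eq [:: x1; y1; x2; y2; x3; y3] [:: y1; x2; x1; y2; y3; x3].
    by clear; apply/permP => q /=; lia.
  split => //; first by rewrite -(perm_uniq pe).
    by move=> v; rewrite sE (perm_mem pe).
  rewrite w1 v1 w3 t1 s1 s2 w2; case: (classical y1) c1 => // /(_ isT) -> _.
  by case: (classical y3); case: (f1); case: (f2); case: (f3).
Qed.

(** A dart supported by the edge of a strand goes from x to y, and the next dart
    along the face starts at mate y. *)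
Lemma strand_face w P s R d : uniq w -> w = P ++ strand_word s ++ R ->
  d \in strand_darts s -> exists x y,
  [/\ d = (x, d.2), s = (if d.2 then (x, y) else (y, x))
    & face w d = (mate y, d.2 == rising y)].
Proof.
case: s => a b uw ew; have rw : rot (size P) w = a :: b :: R ++ P.
  by rewrite ew rot_size_cat.
have nab : next w a = b by rewrite -(next_rot (size P)) // rw /= eqxx.
have pba : prev w b = a by rewrite -nab prev_next.
rewrite !inE /= => /orP[]/eqP->; rewrite /face /=.
  by exists a, b; rewrite nab.
by exists b, a; rewrite pba.
Qed.

(** The moves RIII, VRIII and SV are third moves in the sense above. *)
Lemma triangle_third w1 s1 w2 s2 w3 s3 w4 (ss := [:: s1; s2; s3])
    (w := w1 ++ strand_word s1 ++ w2 ++ strand_word s2 ++ w3 ++ strand_word s3 ++ w4)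
    (w' := w1 ++ strand_word (swap_strand s1) ++ w2 ++ strand_word (swap_strand s2)
             ++ w3 ++ strand_word (swap_strand s3) ++ w4) :
  wf_word w -> triangle w s1 s2 s3 ->
  [|| RIII_strands ss, VRIII_strands ss | SV_strands ss] ->
  third_move (strand_sign ss) (partner ss) w w'.
Proof.
move=> wfw tri lv; have uw := wf_uniq wfw.
have pw : perm_eq w (strand_letters ss ++ (w1 ++ w2 ++ w3 ++ w4)).
  apply/permP => r; rewrite /w /strand_letters /strand_word /=; do 5!rewrite ?count_cat /=.
  by clear; lia.
have := uw; rewrite (perm_uniq pw) cat_uniq => /and3P[uss /hasPn nc _].
have sP s : s \in ss -> _ := strandP uss.
have in1 : s1 \in ss by rewrite !inE eqxx.
have in2 : s2 \in ss by rewrite !inE eqxx orbT.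
have in3 : s3 \in ss by rewrite !inE eqxx !orbT.
split.
  have core u : {subset u <= w1 ++ w2 ++ w3 ++ w4} ->
      flip (strand_sign ss) (partner ss) u u.
    move=> su; apply: patch_id => v /su/nc; apply: contraR.
    by rewrite strand_sign_neq0.
  have pair s A A' : s \in ss -> flip (strand_sign ss) (partner ss) A A' ->
      flip (strand_sign ss) (partner ss) (strand_word s ++ A)
        (strand_word (swap_strand s) ++ A').
    case: s => a b /sP[/= e1 e2 e3 e4] fA.
    apply: (@patch_pair _ _ a b [:: b; a]); rewrite ?e3 ?e4 //.
    by move=> v; rewrite !inE => /orP[]/eqP->; rewrite ?e3 ?e4.
  apply: patch_cat; first by apply: core => v h; rewrite !mem_cat h.
  apply: (pair s1) => //.
  apply: patch_cat; first by apply: core => v h; rewrite !mem_cat h !orbT.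
  apply: (pair s2) => //.
  apply: patch_cat; first by apply: core => v h; rewrite !mem_cat h !orbT.
  by apply: (pair s3) => //; apply: core => v h; rewrite !mem_cat h !orbT.
have pos s d : s \in ss -> d \in strand_darts s -> exists x y,
  [/\ d = (x, d.2), s = (if d.2 then (x, y) else (y, x))
    & face w d = (mate y, d.2 == rising y)].
  have ex : s \in ss -> exists P R, w = P ++ strand_word s ++ R.
    rewrite !inE => /or3P[]/eqP->.
    - by exists w1; eexists.
    - by exists (w1 ++ strand_word s1 ++ w2); eexists; rewrite -!catA.
    - exists (w1 ++ strand_word s1 ++ w2 ++ strand_word s2 ++ w3); exists w4.
      by rewrite /w !catA.
  by move=> /ex[P [R ew]]; exact: strand_face ew.
have cyc t1 t2 t3 d1 d2 d3 : perm_eq [:: t1; t2; t3] ss ->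
    d1 \in strand_darts t1 -> d2 \in strand_darts t2 -> d3 \in strand_darts t3 ->
    fcycle (face w) [:: d1; d2; d3] ->
  {in strand_letters ss, forall a,
    [/\ uniq (hexagon (partner ss) a),
        forall v, (strand_sign ss v != 0) = (v \in hexagon (partner ss) a),
        partner ss (mate (partner ss a)) = mate (partner ss (mate a))
      & wt a != 0 -> strand_sign ss a * wt (partner ss a)
          = strand_sign ss (mate a) * wt (partner ss (mate a))]}.
  move=> pt m1 m2 m3.
  have lv' : [|| RIII_strands [:: t1; t2; t3], VRIII_strands [:: t1; t2; t3]
               | SV_strands [:: t1; t2; t3]].
    move: lv; rewrite /RIII_strands /VRIII_strands /SV_strands.
    by rewrite !(perm_has _ pt) !(perm_all _ pt).
  have i1 : t1 \in ss by rewrite -(perm_mem pt) !inE eqxx.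
  have i2 : t2 \in ss by rewrite -(perm_mem pt) !inE eqxx orbT.
  have i3 : t3 \in ss by rewrite -(perm_mem pt) !inE eqxx !orbT.
  have [x1 [y1 [e1 g1 h1]]] := pos _ _ i1 m1.
  have [x2 [y2 [e2 g2 h2]]] := pos _ _ i2 m2.
  have [x3 [y3 [e3 g3 h3]]] := pos _ _ i3 m3.
  rewrite /= h1 h2 h3 => /and4P[/eqP c1 /eqP c2 /eqP c3 _].
  have [p1 q1 u1 z1] := sP _ i1; have [p2 q2 u2 z2] := sP _ i2.
  have [p3 q3 u3 z3] := sP _ i3.
  move: e1 e2 e3 c1 c2 c3; case: d1 m1 g1 h1 => [? f1]; case: d2 m2 g2 h2 => [? f2].
  case: d3 m3 g3 h3 => [? f3] /= _ g3 _ _ g2 _ _ g1 _.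
  move=> [->] [->] [->] [k1 l1] [k2 l2] [k3 l3].
  have pc s x y (f : bool) : s = (if f then (x, y) else (y, x)) ->
      partner ss s.1 = s.2 -> partner ss s.2 = s.1 ->
      strand_sign ss s.1 = 1 -> strand_sign ss s.2 = -1 ->
    [/\ partner ss x = y, partner ss y = x,
      strand_sign ss x = (if f then 1 else -1) & strand_sign ss y = - strand_sign ss x].
    by move=> ->; case: f => /= -> -> -> ->; rewrite ?opprK.
  have [a1 b1 r1 o1] := pc _ _ _ _ g1 p1 q1 u1 z1.
  have [a2 b2 r2 o2] := pc _ _ _ _ g2 p2 q2 u2 z2.
  have [a3 b3 r3 o3] := pc _ _ _ _ g3 p3 q3 u3 z3.
  have six : perm_eq [:: x1; y1; x2; y2; x3; y3] (strand_letters ss).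
    have : perm_eq (strand_letters [:: t1; t2; t3]) (strand_letters ss).
      exact/perm_flatten/perm_map.
    apply: perm_trans; rewrite g1 g2 g3; case: (f1); case: (f2); case: (f3);
      by apply/permP => r /=; clear; lia.
  have usix : uniq [:: x1; y1; x2; y2; x3; y3] by rewrite (perm_uniq six).
  have ssix v : (strand_sign ss v != 0) = (v \in [:: x1; y1; x2; y2; x3; y3]).
    by rewrite strand_sign_neq0 (perm_mem six).
  have ris (f f' r : bool) : (f == r) = f' -> r = (f == f').
    by case: f; case: f'; case: r.
  have [L1 L2 L3] : [/\ classical y1 -> classical y2 = classical y3,
      classical y2 -> classical y3 = classical y1
    & classical y3 -> classical y1 = classical y2].
    move: lv'; rewrite /RIII_strands /VRIII_strands /SV_strands g1 g2 g3.
    rewrite /along /classical /= -k1 -k2 -k3 /=.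
    clear; case: (f1); case: (f2); case: (f3) => /=;
      case: (lev y1); case: (lev y2); case: (lev y3) => H; split => h;
      by move: H h; vm_compute.
  move=> a; rewrite -(perm_mem six) => ain.
  have T1 := @triangle_corner (strand_sign ss) (partner ss) x1 y1 x2 y2 x3 y3 f1 f2 f3.
  have T2 := @triangle_corner (strand_sign ss) (partner ss) x2 y2 x3 y3 x1 y1 f2 f3 f1.
  have T3 := @triangle_corner (strand_sign ss) (partner ss) x3 y3 x1 y1 x2 y2 f3 f1 f2.
  have ps2 : perm_eq [:: x1; y1; x2; y2; x3; y3] [:: x2; y2; x3; y3; x1; y1].
    by clear; apply/permP => r /=; lia.
  have ps3 : perm_eq [:: x1; y1; x2; y2; x3; y3] [:: x3; y3; x1; y1; x2; y2].
    by clear; apply/permP => r /=; lia.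
  have [h|[h|h]] : a \in [:: x1; y1] \/ a \in [:: x2; y2] \/ a \in [:: x3; y3].
    by move: ain; rewrite !inE => /or4P[->|->|->|/or3P[]->]; rewrite ?orbT; auto.
  - by apply: T1 => //; split => //; exact: ris.
  - apply: T2 => //; try (by split => //; exact: ris); first by rewrite -(perm_uniq ps2).
    by move=> v; rewrite ssix (perm_mem ps2).
  apply: T3 => //; try (by split => //; exact: ris); first by rewrite -(perm_uniq ps3).
  by move=> v; rewrite ssix (perm_mem ps3).
move=> a _; rewrite strand_sign_neq0 => ain.
have [d1 [d2 [d3 [m1 m2 m3 [c|c]]]]] := tri.
  exact: (cyc s1 s2 s3 d1 d2 d3).
apply: (cyc s1 s3 s2 d1 d3 d2) => //.
by rewrite perm_cons; exact: permEl (perm_catC [:: s3] [:: s2]).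
Qed.

(** * Invariance *)

Lemma Fpoly_isotopy n c c' : planar_isotopy c c' -> wf_word c.1 ->
  Fpoly n c.1 = Fpoly n c'.1.
Proof.
case=> [f w b fi|v0 w b k b' _ _] /= wfw; first by rewrite Fpoly_rename.
by rewrite Fpoly_rot.
Qed.

Lemma Fpoly_reidemeister n c c' : reidemeister c c' -> wf_word c.1 -> wf_word c'.1 ->
  Fpoly n c.1 = Fpoly n c'.1.
Proof.
case=> [w1 w2 v b|w1 w2 w3 p q s b lpq rpq es|w1 w2 w3 w4 s1 s2 s3 b tri lv] /= wfw wfw'.
- exact: Fpoly_first.
- exact: Fpoly_second.
- exact: Fpoly_third wfw (triangle_third wfw tri lv).
Qed.

Lemma Fpoly_invariant n (D D' : diagram) : diagram_equiv D D' -> Fpoly n D = Fpoly n D'.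
Proof.
elim=> [D1 D2 [h|h]|D1|D1 D2 _ e|D1 D2 D3 _ e1 _ e2].
- exact: (Fpoly_isotopy n h (dword_wf D1)).
- exact: (Fpoly_reidemeister n h (dword_wf D1) (dword_wf D2)).
- exact: erefl.
- exact: esym e.
- exact (eq_trans e1 e2).
Qed.

Lemma repr_pi_equiv (D : diagram) : diagram_equiv (repr (\pi_vknot D)) D.
Proof.
have /eqmodP h : repr (\pi_vknot D) = D %[mod_eq diagram_eqv] by rewrite reprK.
exact/asboolP.
Qed.

(** The representative chosen to compute F does not matter. *)
Lemma knotF_pi n (D : diagram) : knotF n (\pi_vknot D) = Fpoly n D.
Proof. exact: Fpoly_invariant (repr_pi_equiv D). Qed.

(** * The L-polynomial is a function of the F-polynomial *)

(** The coefficients, as a function of the exponent j, after every exponent has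
    been replaced by its absolute value. *)
Definition fold_exponent (f : int -> int) (j : int) : int :=
  if 0 < j then f j + f (- j) else if j == 0 then f 0 else 0.

Lemma mcoeff_laurent_sum (s : seq visit) (F : visit -> laurent) k :
  (\sum_(c <- s) F c)@_k = \sum_(c <- s) (F c)@_k.
Proof. exact: raddf_sum. Qed.

Lemma mcoeff_term s i a k j :
  (term s i a)@_(k, j) = if (i == k) && (a == j) then s else 0.
Proof. by rewrite mcoeffU xpair_eqE mulrb. Qed.

Lemma mcoeff_Fsummand s i a d k j :
  (Fsummand s i a d)@_(k, j)
  = (if (i == k) && (a == j) then s else 0)
    - (if (0 == k) && ((if (a == d) || (a == - d) then a else d) == j) then s else 0).
Proof. by rewrite /Fsummand mcoeffB !mcoeff_term. Qed.

Lemma fold_exponent_sum (s : seq visit) (f : visit -> int -> int) j :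
  fold_exponent (fun x => \sum_(c <- s) f c x) j = \sum_(c <- s) fold_exponent (f c) j.
Proof.
rewrite /fold_exponent; case: (0 < j); first by rewrite big_split.
by case: (j == 0) => //; rewrite big1.
Qed.

Lemma fold_exponent_term (s a j : int) (P : bool) :
  fold_exponent (fun x => if P && (a == x) then s else 0) j
  = if P && (`|a| == j) then s else 0.
Proof.
rewrite /fold_exponent; case: P => /=; last by case: (0 < j) => //; case: (j == 0).
by do ?case: ifP => ?; lia.
Qed.

Lemma fold_exponentB f g j :
  fold_exponent (fun x => f x - g x) j = fold_exponent f j - fold_exponent g j.
Proof.
rewrite /fold_exponent; case: (0 < j); first by ring.
by case: (j == 0); rewrite ?subrr.
Qed.

(** L is obtained from F by taking absolute values of the exponents of l. *)
Lemma Lpoly_coeff n w k j :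
  (Lpoly n w)@_(k, j) = fold_exponent (fun x => (Fpoly n w)@_(k, x)) j.
Proof.
rewrite /Lpoly mcoeff_laurent_sum.
transitivity (\sum_(c <- crossings w) fold_exponent (fun x => (Fterm n w c)@_(k, x)) j).
  apply: eq_bigr => c _; rewrite mcoeffB !mcoeff_term.
  set a := dwrithe n (smooth w c); set d := dwrithe n w.
  have -> : fold_exponent (fun x => (Fterm n w c)@_(k, x)) j
      = fold_exponent (fun x => (if (Ind w c == k) && (a == x) then sgn c else 0)
          - (if (0 == k) && ((if (a == d) || (a == - d) then a else d) == x)
             then sgn c else 0)) j.
    by rewrite /fold_exponent /Fterm -/a -/d !mcoeff_Fsummand.
  rewrite fold_exponentB !fold_exponent_term; congr (_ - _).
  have -> : `|if (a == d) || (a == - d) then a else d| = `|d|; last by [].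
  by case: ifP => // /orP[]/eqP->; rewrite ?normrN.
rewrite -fold_exponent_sum /fold_exponent FpolyE !mcoeff_laurent_sum.
by [].
Qed.

Lemma Lpoly_of_Fpoly n w w' : Fpoly n w = Fpoly n w' -> Lpoly n w = Lpoly n w'.
Proof.
move=> e; apply/malgP => -[k j].
pose fold (F : laurent) := fold_exponent (fun x => F@_(k, x)) j.
apply: (eq_trans (Lpoly_coeff n w k j)).
apply: (eq_trans (congr1 fold e)).
exact: (esym (Lpoly_coeff n w' k j)).
Qed.

Lemma knotL_pi n (D : diagram) : knotL n (\pi_vknot D) = Lpoly n D.
Proof. exact: (Lpoly_of_Fpoly (knotF_pi n D)). Qed.

(** * Switching all crossings and reflecting the plane *)

Lemma chain_opp e Q z u : chain e Q z u -> chain (fun v => - e v) (fun v => - Q v) (- z) u.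
Proof. by elim: u z => //= x u IH z [-> /IH]; rewrite opprD. Qed.

(** Exchanging the names of the two visits to every double point negates both
    the weights and the gaps. *)
Lemma flat_writhe_mirror n e u : closed_word u -> odd_on e u ->
  flat_writhe n e (map mate u) = flat_writhe n e u.
Proof.
move=> cu oe; have [uu mu] := cu; rewrite flat_writhe_map_mate //.
rewrite (flat_writhe_chain n cu (chain_opp (chain_pre e uu))) sumrN /flat_writhe.
rewrite -[RHS]opprK -(sum_gap_opp n (pre e u) cu oe); congr (- _).
by apply: eq_bigl => v; congr (_ == _); rewrite /gap; ring.
Qed.

(** Switching a crossing exchanges its levels and reflecting the plane exchanges
    rising and falling strands, so together they turn each visit into its mate. *)
Definition mirror (w : word) : word := map mate w.

Section Mirror.

Variable w : word.
Hypothesis wfw : wf_word w.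

Let cw : closed_word w. Proof. exact: closed_wf. Qed.

Lemma wf_mirror : wf_word (mirror w).
Proof. by apply: wf_perm wfw; rewrite perm_sym; exact: closed_perm_mate. Qed.

Lemma crossings_mirror : perm_eq (crossings (mirror w)) (crossings w).
Proof. exact: perm_filter (closed_perm_mate cw). Qed.

Lemma dwrithe_mirror n : dwrithe n (mirror w) = dwrithe n w.
Proof.
rewrite !dwritheE ?wf_mirror //; apply: flat_writhe_mirror => //; exact: wt_odd.
Qed.

Lemma chain_mirror Q z u : chain wt Q z u ->
  chain wt (fun v => - Q (mate v)) (- z) (map mate u).
Proof.
by move=> ch; apply/chain_map; apply: eq_chain (chain_opp ch) => v _ /=;
  rewrite ?wt_mate ?mateK.
Qed.

Lemma Ind_mirror c : c \in crossings w -> Ind (mirror w) c = Ind w c.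
Proof.
move=> cc; have cm : c \in crossings (mirror w) by rewrite (perm_mem crossings_mirror).
rewrite (Ind_chain wf_mirror cm (chain_mirror (chain_pre wt (wf_uniq wfw)))).
by rewrite Ind_gap // /gap mateK; ring.
Qed.

(** At c the paths from over to under and from under to over are exchanged, so
    the smoothing gets the opposite orientation. *)
Lemma dwrithe_smooth_mirror n c : c \in w ->
  dwrithe n (smooth (mirror w) c) = - dwrithe n (smooth w c).
Proof.
move=> cin; have [k [A [B ew]]] := rot_split wfw cin.
have [k' ek'] : exists k', rot k' (mirror w) = c :: mirror B ++ mate c :: mirror A.
  have [m em] := rot_rot_ex k (size (mate c :: mirror A)) (mirror w).
  exists m; rewrite -em /mirror -map_rot ew /= map_cat /= mateK.
  exact: (rot_size_cat (mate c :: map mate A) (c :: map mate B)).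
have cu := smooth_closed wfw ew; have [uu mu] := cu.
rewrite (dwrithe_smooth wf_mirror ek') (dwrithe_smooth wfw ew).
have eu : mirror B ++ rev (mirror A) = map mate (rev (A ++ rev B)).
  by rewrite rev_cat revK map_cat map_rev.
have cr : closed_word (rev (A ++ rev B)).
  by apply: closed_word_perm cu; rewrite perm_sym perm_rev.
rewrite eu flat_writhe_mirror ?flat_writhe_rev //; try exact: swt_odd.
congr (- _); apply: eq_flat_writhe => // v vu.
have sB x : x \in A ++ rev B -> (x \in B) = (x \notin A).
  move: uu; rewrite cat_uniq => /and3P[_ /hasPn hn _].
  rewrite mem_cat mem_rev; have [xA _|xA /= -> //] := boolP (x \in A).
  by apply/negP => xB; have := hn x; rewrite mem_rev xB xA => /(_ isT).
have sM x : (x \in mirror B) = (mate x \in B).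
  by rewrite -{1}[x]mateK /mirror mem_map //; exact: mate_inj.
rewrite /swt !sM mateK !sB ?mu //.
by case: (v \in A); case: (mate v \in A).
Qed.

Lemma Lpoly_mirror n : Lpoly n (mirror w) = Lpoly n w.
Proof.
apply: (sum_perm_cat (s0 := [::]) (s' := crossings w) crossings_mirror).
  by rewrite big_nil.
move=> c cc; have cin : c \in w by move: cc; rewrite mem_crossings => /andP[].
by rewrite (Ind_mirror cc) (dwrithe_smooth_mirror n cin) (dwrithe_mirror n) normrN.
Qed.

End Mirror.

(** For k <> 0 only the first of the three sums defining F contributes. *)
Lemma Fpoly_coeff n w k j : k != 0 ->
  (Fpoly n w)@_(k, j)
  = \sum_(c <- crossings w | (Ind w c == k) && (dwrithe n (smooth w c) == j)) sgn c.
Proof.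
move=> k0; rewrite FpolyE mcoeff_laurent_sum [RHS]big_mkcond; apply: eq_bigr => c _.
by rewrite mcoeff_Fsummand [0 == k]eq_sym (negPf k0) subr0.
Qed.

(** * A knot distinguished from its image by the F-polynomial only *)

(** The faces obtained by following l, a list of starting darts and lengths. *)
Definition faces_from (w : word) (l : seq (dart * nat)) : seq (seq dart) :=
  [seq traject (face w) x.1 x.2 | x <- l].

(** A computable certificate of planarity. *)
Definition check_planar (w : word) (l : seq (dart * nat)) : bool :=
  let fs := faces_from w l in
  [&& size fs == ((size w)./2 + 2)%N,
      all (fun f => (f != [::]) && fcycle (face w) f) fs
    & perm_eq (flatten fs) (darts w)].

Lemma check_planarP w l : check_planar w l -> planar w.
Proof. by case/and3P=> /eqP s a p; right; exists (faces_from w l). Qed.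

(** Four positive classical crossings, named 0 to 3, and two virtual ones, named
    4 and 5. The crossings 0, 2, 3, 1 have indices 1, 1, 0, -2, and their
    smoothings have first dwrithes 2, 0, 0, 0. *)
Definition example_word : word :=
  [:: Visit 0 Under false; Visit 4 Virtual true; Visit 1 Under false;
      Visit 0 Over true; Visit 2 Over true; Visit 5 Virtual false;
      Visit 3 Over true; Visit 2 Under false; Visit 4 Virtual false;
      Visit 1 Over true; Visit 5 Virtual true; Visit 3 Under false].

(** Starting darts of faces, given by the position of a visit in the word. *)
Definition example_faces (w : word) (l : seq (nat * bool * nat)) : seq (dart * nat) :=
  [seq (nth (Visit 0 Over true) w x.1.1, x.1.2, x.2) | x <- l].

Lemma example_wf : wf_word example_word.
Proof. by vm_compute. Qed.

Lemma example_planar : planar example_word.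
Proof.
apply: (@check_planarP _ (example_faces example_word
  [:: (0, true, 3); (0, false, 3); (1, true, 2); (1, false, 3);
      (2, false, 4); (3, false, 4); (5, false, 3); (6, false, 2)]%N)).
by vm_compute.
Qed.

Lemma example_mirror_planar : planar (mirror example_word).
Proof.
apply: (@check_planarP _ (example_faces (mirror example_word)
  [:: (0, true, 3); (0, false, 4); (1, true, 4); (1, false, 3);
      (2, false, 2); (3, true, 3); (4, true, 3); (5, true, 2)]%N)).
by vm_compute.
Qed.

Definition example_diagram : diagram :=
  Diagram true example_wf example_planar.

Definition example_mirror_diagram : diagram :=
  Diagram true (wf_mirror example_wf) example_mirror_planar.

Lemma Fpoly_mirror_coeff n w k j : wf_word w -> k != 0 ->
  (Fpoly n (mirror w))@_(k, j) = (Fpoly n w)@_(k, - j).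
Proof.
move=> wfw k0; rewrite !Fpoly_coeff // (perm_big _ (crossings_mirror wfw)) /=.
rewrite big_seq_cond [RHS]big_seq_cond; apply: eq_bigl => c.
case cc: (c \in crossings w) => //=; rewrite Ind_mirror // dwrithe_smooth_mirror //.
  by rewrite eqr_oppLR.
by move: cc; rewrite mem_crossings => /andP[].
Qed.

Lemma example_coeff j :
  (Fpoly 1 example_word)@_(1, j) = (if 2 == j then 1 else 0) + (if 0 == j then 1 else 0).
Proof.
rewrite Fpoly_coeff //.
have Is c : c \in crossings example_word ->
  Ind example_word c = gap wt (pre wt example_word) c := Ind_gap example_wf (c := c).
have Ds c : wf_word (smooth example_word c) ->
    dwrithe 1 (smooth example_word c) = flat_writhe 1 wt (smooth example_word c).
  exact: dwritheE.
pose c i := Visit i Over true.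
have -> : crossings example_word = [:: c 0%N; c 2%N; c 3%N; c 1%N] by [].
have I0 : Ind example_word (c 0%N) = 1 by rewrite Is.
have I1 : Ind example_word (c 1%N) = - 2 by rewrite Is.
have I2 : Ind example_word (c 2%N) = 1 by rewrite Is.
have I3 : Ind example_word (c 3%N) = 0 by rewrite Is.
have D0 : dwrithe 1 (smooth example_word (c 0%N)) = 2.
  by rewrite Ds; [rewrite /flat_writhe unlock; vm_compute | vm_compute].
have D2 : dwrithe 1 (smooth example_word (c 2%N)) = 0.
  by rewrite Ds; [rewrite /flat_writhe unlock; vm_compute | vm_compute].
have key (f g h : visit -> int) (v0 v1 v2 v3 : visit) :
    f v0 = 1 -> f v1 = - 2 -> f v2 = 1 -> f v3 = 0 -> g v0 = 2 -> g v2 = 0 ->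
    h v0 = 1 -> h v2 = 1 ->
    \sum_(v <- [:: v0; v2; v3; v1] | (f v == 1) && (g v == j)) h v
    = (if 2 == j then 1 else 0) + (if 0 == j then 1 else 0).
  move=> f0 f1 f2 f3 g0 g2 h0 h2; rewrite big_mkcond !big_cons big_nil.
  by rewrite f0 f1 f2 f3 g0 g2 h0 h2 /= !addr0.
exact: (key (Ind example_word) (fun v => dwrithe 1 (smooth example_word v)) sgn
  _ _ _ _ I0 I1 I2 I3 D0 D2).
Qed.

Theorem proposition6p5 :
  (forall K1 K2 : vknot,
     (exists n : nat, (0 < n)%N /\ knotL n K1 <> knotL n K2) ->
     exists m : nat, (0 < m)%N /\ knotF m K1 <> knotF m K2)
  /\
  (exists K K' : vknot,
     (forall n : nat, (0 < n)%N -> knotL n K = knotL n K') /\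
     exists m : nat, (0 < m)%N /\ knotF m K <> knotF m K').
Proof.
split=> [K1 K2 [n [n0 neL]]|].
  by exists n; split; [exact: n0 | move=> eF; exact: (neL (Lpoly_of_Fpoly eF))].
exists (\pi_vknot example_diagram), (\pi_vknot example_mirror_diagram); split=> [n _|].
  apply: (eq_trans (knotL_pi n example_diagram)).
  apply: (eq_trans (esym (Lpoly_mirror example_wf n))).
  exact: (esym (knotL_pi n example_mirror_diagram)).
exists 1%N; split; first by [].
move=> eF.
have e : Fpoly 1 example_word = Fpoly 1 (mirror example_word).
  exact: (eq_trans (esym (knotF_pi 1 example_diagram))
    (eq_trans eF (knotF_pi 1 example_mirror_diagram))).
have h := eq_trans (congr1 (mcoeff (1 : int, 2 : int)) e)
  (@Fpoly_mirror_coeff 1 example_word 1 2 example_wf isT).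
by have := eq_trans (esym (example_coeff 2)) (eq_trans h (example_coeff (- 2))).
Qed.
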